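(* Let $x>0$. There is a constant $c>0$ such that for all sufficiently large primes $p$, there exist at least $c\,p/\sqrt{\log p}$ even Dirichlet characters $\chi$ modulo $p$ such that $\theta(x,\chi)\neq 0$, where $$\theta(x,\chi)=\sum_{n\geq 1}\chi(n)\,e^{-\pi n^2 x/p}.$$
   Context: A Dirichlet character $\chi$ modulo $p$ is even if $\chi(-1)=1$; there are $(p-1)/2$ such characters for an odd prime $p$. The paper states the lower bound as ''$\gg p/\sqrt{\log p}$''; the constant $c$ may depend on $x$. *)

(* Defs.v *)
From HB Require Import structures.
From mathcomp Require Import all_boot all_order all_algebra.
From mathcomp Require Import finmap.
From mathcomp Require Import all_classical all_reals all_analysis.
From mathcomp Require Import complex.

Set Implicit Arguments.
Unset Strict Implicit.
Unset Printing Implicit Defensive.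

Import Order.TTheory GRing.Theory Num.Theory.
Import numFieldNormedType.Exports.

Local Open Scope classical_set_scope.
Local Open Scope ring_scope.
Local Open Scope complex_scope.

(* A Dirichlet character modulo a prime p is a function on Z/pZ = 'F_p;
   its value at a natural number n is chi n%:R.  The type 'F_p denotes Z/pZ
   only when p is prime. *)
Record dirichlet_character (R : realType) (p : nat)
    (chi : {ffun 'F_p -> R[i]}) : Prop := DirichletCharacter {
  dirichlet_character1 : chi 1 = 1;
  dirichlet_characterM : forall a b : 'F_p, chi (a * b) = chi a * chi b;
  dirichlet_character_eq0 :
    forall a : 'F_p, chi a = 0 <-> a \isn't a GRing.unit }.

Definition even_character (R : realType) (p : nat)
    (chi : {ffun 'F_p -> R[i]}) : Prop := chi (- 1) = 1.

(* R[i]^o is R[i] with the topology of its absolute value. *)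
Definition theta (R : realType) (p : nat) (x : R)
    (chi : {ffun 'F_p -> R[i]}) : R[i] :=
  limn (fun N => \sum_(1 <= n < N)
    chi n%:R * (expR (- (pi * n%:R ^+ 2 * x / p%:R)))%:C : R[i]^o).

(* Main.v *)
(* Cauchy-Schwarz with a mollifier.  Let N = floor (sqrt p), L = sqrt (log N),
   and let A be the set of m <= N free of prime factors <= z, where
   z is about exp L.  Put M(chi) = sum_(m in A) chi m.  Summing over the even
   characters, orthogonality gives
   - sum theta(chi) * conj M(chi) >> p |A|, from the diagonal n = m;
   - sum |theta(chi) M(chi)|^2 << p sqrt p sum_(m1, m2 in A) gcd / max,
     because for fixed m1, m2 the solutions of n1 m1 = +- n2 m2 (mod p) lie in
     residue classes modulo m2 / gcd.
   As |A| has order N / L and the last sum over m1, m2 is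
   << N / L + N log N / L^3 << N / L, the number of chi with theta(chi) <> 0 is
   >> p (N / sqrt p) / L >> p / sqrt (log p).

   The estimates on A are elementary.  If R and S are the sums of 1 / n over the
   z-rough and the z-smooth n <= X, then R S lies between log X and 1 + 2 log X,
   and S has order log z; Chebyshev's bounds on psi turn this information on R
   into bounds for the number of rough integers. *)
Require Import Defs.
From HB Require Import structures.
From mathcomp Require Import all_boot all_order all_algebra.
From mathcomp Require Import finmap.
From mathcomp Require Import all_classical all_reals all_analysis.
From mathcomp Require Import complex.
From mathcomp Require Import cyclic separable cyclotomic finfield.
From mathcomp Require Import zify ring lra.

Set Implicit Arguments.
Unset Strict Implicit.
Unset Printing Implicit Defensive.

Import Order.TTheory GRing.Theory Num.Theory.
Import numFieldNormedType.Exports.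

Local Open Scope ring_scope.

(** * The von Mangoldt function and Chebyshev's bounds *)

(** An injection along which no term decreases compares the sums, since the terms outside its image
    are nonnegative. It carries the regroupings below that need only an inequality. *)
Lemma ler_sum_inj (R : numDomainType) (I J : eqType) (r : seq I) (s : seq J)
    (P : pred I) (Q : pred J) (f : I -> J) (F : I -> R) (G : J -> R) :
  uniq r -> uniq s ->
  (forall i, i \in r -> P i -> [/\ f i \in s, Q (f i) & F i <= G (f i)]) ->
  (forall i i', i \in r -> P i -> i' \in r -> P i' -> f i = f i' -> i = i') ->
  (forall j, 0 <= G j) ->
  \sum_(i <- r | P i) F i <= \sum_(j <- s | Q j) G j.
Proof.
move=> ur us fP finj G0.
have sub (t s' : seq J) : uniq t -> uniq s' -> {subset t <= s'} ->
    \sum_(j <- t) G j <= \sum_(j <- s') G j.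
  elim: t s' => [|x t IH] s'; first by rewrite big_nil sumr_ge0.
  move=> /= /andP[xt ut] us' ts'.
  rewrite big_cons (big_rem x (ts' x (mem_head _ _))) /= lerD2l IH ?rem_uniq //.
  move=> y yt; rewrite mem_rem_uniq // !inE ts' ?inE ?yt ?orbT // andbT.
  by apply: contraNneq xt => <-.
rewrite -big_filter -[leRHS]big_filter.
apply: (@le_trans _ _ (\sum_(j <- map f [seq i <- r | P i]) G j)).
  rewrite big_map big_seq [leRHS]big_seq ler_sum // => i.
  rewrite mem_filter => /andP[Pi ir]; by have [] := fP i ir Pi.
apply: sub; rewrite ?filter_uniq //.
  rewrite map_inj_in_uniq ?filter_uniq // => i i'.
  by rewrite !mem_filter => /andP[? ?] /andP[? ?]; exact: finj.
move=> _ /mapP[i + ->]; rewrite !mem_filter => /andP[Pi ir].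
by have [-> ->] := fP i ir Pi.
Qed.

Lemma sum_dvd_div (V : nmodType) (d X : nat) (G : nat -> V) : (0 < d)%N ->
  \sum_(1 <= n < X.+1 | (d %| n)%N) G (n %/ d)%N =
  \sum_(1 <= m < (X %/ d).+1) G m.
Proof.
move=> d0; elim: X => [|X IH]; first by rewrite div0n !big_geq.
rewrite big_mkcond big_nat_recr //= -big_mkcond /= IH divnS //.
case: ifP => [dX|_]; last by rewrite addr0 add0n.
by rewrite add1n [RHS]big_nat_recr //= dX add1n.
Qed.

Section VonMangoldt.
Variable R : realType.
Implicit Types d n q k : nat.

Lemma ln_nat_ge0 n : 0 <= ln n%:R :> R.
Proof. by case: n => [|n]; [rewrite ln0 | rewrite ln_ge0 // ler1n]. Qed.

Lemma ln_prod_nat (I : Type) (r : seq I) (P : pred I) (F : I -> nat) :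
  (forall i, P i -> (0 < F i)%N) ->
  ln (\prod_(i <- r | P i) F i)%N%:R = \sum_(i <- r | P i) ln (F i)%:R :> R.
Proof.
move=> F0; suff [] : (0 < \prod_(i <- r | P i) F i)%N /\
  ln (\prod_(i <- r | P i) F i)%N%:R =
    \sum_(i <- r | P i) ln (F i)%:R :> R by [].
apply: (big_ind2 (fun x y => (0 < x)%N /\ ln x%:R = y)) => //.
- by rewrite ln1.
- move=> x1 x2 y1 y2 [x10 <-] [y10 <-]; rewrite muln_gt0 x10 y10; split=> //.
  by rewrite natrM lnM // posrE ltr0n.
- by move=> i /F0.
Qed.

(** A double sum over prime powers, so that it can be exchanged with other sums. The range of [k]
    loses nothing, since [k < q ^ k]. *)
Definition vonMangoldt d : R :=
  \sum_(1 <= q < d.+1 | prime q) \sum_(1 <= k < d.+1 | (q ^ k == d)%N) ln q%:R.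

Lemma vonMangoldt_ge0 d : 0 <= vonMangoldt d.
Proof. by do 2 ![apply: sumr_ge0 => ? _]; exact: ln_nat_ge0. Qed.

(** Both inner ranges extend to the common bound [B] because [q <= q ^ k] and [k < q ^ k];
    exchanging the sums then eliminates [d]. *)
Lemma sum_vonMangoldt (P : pred nat) B :
  \sum_(1 <= d < B.+1 | P d) vonMangoldt d =
  \sum_(1 <= q < B.+1 | prime q)
    \sum_(1 <= k < B.+1 | P (q ^ k)%N && (q ^ k <= B)%N) ln q%:R.
Proof.
transitivity (\sum_(1 <= d < B.+1 | P d) \sum_(1 <= q < B.+1 | prime q)
    \sum_(1 <= k < B.+1 | (q ^ k == d)%N) (ln q%:R : R)).
  apply: congr_big_nat => // d; rewrite ltnS => /andP[Pd /andP[d1 dB]].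
  rewrite [RHS](@big_cat_nat _ _ _ d.+1) //= [X in _ = _ + X]big1_seq ?addr0.
    rewrite /vonMangoldt.
    apply: congr_big_nat => // q; rewrite ltnS => /andP[pq /andP[q1 qd]].
    rewrite [RHS](@big_cat_nat _ _ _ d.+1) //= [X in _ =
      _ + X]big1_seq ?addr0 //.
    move=> k; rewrite mem_index_iota => /andP[/eqP qkd /andP[dk _]].
    by have := ltn_expl k (prime_gt1 pq); rewrite qkd; lia.
  move=> q; rewrite mem_index_iota => /andP[pq /andP[dq _]].
  rewrite big1_seq // => k; rewrite mem_index_iota => /andP[/eqP qkd].
  move=> /andP[k1 _]; have : (q ^ 1 <=
    q ^ k)%N by rewrite leq_pexp2l // prime_gt0.
  by rewrite qkd expn1; lia.
rewrite exchange_big; apply: eq_bigr => q pq.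
rewrite (exchange_big_dep predT) //= [RHS]big_mkcond; apply: eq_bigr => k _.
under eq_bigl => d do rewrite eq_sym.
rewrite big_nat1_cond_eq /= ltnS expn_gt0 prime_gt0 //= andbC.
by [].
Qed.

Lemma ln_prime_decomp n B : (0 < n <= B)%N ->
  ln n%:R = \sum_(1 <= q < B.+1 | prime q) (logn q n)%:R * ln q%:R :> R.
Proof.
move=> /andP[n0 nB]; rewrite -[in LHS](partnT n0) /partn ln_prod_nat;
  last first.
  by case=> [|i] _; [rewrite lognE | rewrite expn_gt0].
rewrite big_nat_recl // lognE expn0 ln1 add0r.
rewrite [RHS](@big_cat_nat _ _ _ n.+1) //= [X in _ = _ + X]big1_seq ?addr0.
  rewrite [RHS]big_mkcond big_add1; apply: eq_bigr => q _.
  case: ifPn => pq; last by rewrite lognE (negbTE pq) ln1.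
  by rewrite natrX lnXn ?ltr0n // mulr_natl.
move=> q; rewrite mem_index_iota => /andP[pq /andP[nq _]].
by rewrite lognE pq n0 gtnNdvd // mul0r.
Qed.

(** The exponent of [q] in [n] is the number of [k >= 1] such that [q ^ k] divides [n]. *)
Lemma sum_vonMangoldt_dvd n : (0 < n)%N ->
  \sum_(1 <= d < n.+1 | (d %| n)%N) vonMangoldt d = ln n%:R.
Proof.
move=> n0; rewrite sum_vonMangoldt (@ln_prime_decomp n n) ?n0 ?leqnn //.
apply: eq_bigr => q pq; rewrite logn_count_dvd // mulr_natl.
have -> : (\sum_(1 <= k < n) (q ^ k %| n) =
           \sum_(1 <= k < n.+1) (q ^ k %| n))%N.
  by rewrite big_nat_recr //= gtnNdvd ?addn0 // ltn_expl // prime_gt1.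
rewrite -sumrMnr big_mkcond; apply: eq_bigr => k _.
have [qkn|] := boolP (q ^ k %| n)%N; last by rewrite mulr0n.
by rewrite dvdn_leq.
Qed.

End VonMangoldt.

(** Nested sums become sums over pairs, the form to which [ler_sum_inj] applies. *)
Lemma sum_pair_seq (V : nmodType) (I J : Type) (r : seq I) (s : seq J)
    (P : pred I) (Q : I -> pred J) (F : I -> J -> V) :
  \sum_(i <- r | P i) \sum_(j <- s | Q i j) F i j =
  \sum_(x <- [seq (i, j) | i <- r, j <- s] | P x.1 && Q x.1 x.2) F x.1 x.2.
Proof.
rewrite [RHS]big_mkcond big_allpairs [LHS]big_mkcond; apply: eq_bigr => i _ /=.
by case: ifP => Pi /=; [rewrite big_mkcond | rewrite big1].
Qed.

(** * Chebyshev's bounds for [psi] *)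

Section Chebyshev.
Variable R : realType.
Implicit Types d m n X : nat.

Lemma ln2_bounds : 1 / 2 <= ln 2 :> R /\ ln 2 <= 1 :> R.
Proof.
split; last by rewrite -[2]/(1 + 1) le_ln1Dx.
rewrite -lerN2 -lnV ?posrE //; have -> : 2^-1 = 1 + - (1 / 2) :> R by lra.
by apply: le_trans (le_ln1Dx _) _; lra.
Qed.

(** Expand [ln n] over the divisors [d] of [n] and write [n = d * m]. The predicate [P] is trivial
    for factorials and is [rough z] in the sieve. *)
Lemma sum_ln (P : pred nat) X :
  \sum_(1 <= n < X.+1 | P n) ln n%:R =
  \sum_(1 <= d < X.+1) \sum_(1 <= m < X.+1 | (d * m <= X)%N && P (d * m)%N)
    vonMangoldt R d.
Proof.
transitivity (\sum_(1 <= n < X.+1 | P n)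
    \sum_(1 <= d < X.+1 | (d %| n)%N) vonMangoldt R d).
  apply: congr_big_nat => // n; rewrite ltnS => /andP[Pn /andP[n1 nX]].
  rewrite -sum_vonMangoldt_dvd // [RHS](@big_cat_nat _ _ _ n.+1) //=.
  rewrite [X in _ = _ + X]big1_seq ?addr0 // => d.
  by rewrite mem_index_iota => /andP[/dvdn_leq]; lia.
rewrite (exchange_big_dep predT) //=.
apply: congr_big_nat => // d; rewrite ltnS => /andP[_ /andP[d1 dX]].
transitivity (\sum_(1 <= n < X.+1 | (d %| n)%N)
    if P (d * (n %/ d))%N then vonMangoldt R d else 0).
  rewrite big_mkcond [RHS]big_mkcond; apply: eq_bigr => n _.
  have [dn|_] := boolP (d %| n)%N; last by rewrite andbF.
  by rewrite andbT mulnC divnK.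
rewrite (@sum_dvd_div _ _ _ (fun m => if P (d * m)%N then _ else _)) //.
rewrite -big_mkcond /= (@big_nat_widen _ _ _ _ _ X.+1) ?ltnS ?leq_div //.
by apply: eq_bigl => m; rewrite andbC ltnS leq_divRL // mulnC.
Qed.

(** Legendre's formula in logarithmic form. Any [X >= n] is allowed, so that the expansions for [n]
    and [n.*2] can share one range. *)
Lemma ln_fact n X : (n <= X)%N ->
  ln n`!%:R = \sum_(1 <= d < X.+1) vonMangoldt R d * (n %/ d)%:R.
Proof.
move=> nX; rewrite fact_prod big_nat ln_prod_nat => [|i /andP[]//].
rewrite -big_nat (sum_ln predT).
rewrite [RHS](@big_cat_nat _ _ _ n.+1) //= [X in _ = _ + X]big1_seq ?addr0;
  last first.
  by move=> d; rewrite mem_index_iota /= => /andP[nd _];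
    rewrite divn_small ?mulr0.
apply: eq_big_nat => d /andP[d1 dn].
rewrite (eq_bigl (fun m => m < (n %/ d).+1)%N); last first.
  by move=> m; rewrite ltnS leq_divRL // mulnC andbT.
rewrite (eq_bigl (fun m => predT m && (m < (n %/ d).+1)%N)) //.
rewrite -big_nat_widen ?ltnS ?leq_div //.
by rewrite sumr_const_nat subSS subn0 mulr_natr.
Qed.

Definition psi n : R := \sum_(1 <= d < n.+1) vonMangoldt R d.

Lemma le_psi m n : (m <= n)%N -> psi m <= psi n.
Proof.
move=> mn; rewrite /psi [leRHS](@big_cat_nat _ _ _ m.+1) //= lerDl.
by apply: sumr_ge0 => d _; exact: vonMangoldt_ge0.
Qed.

(** The middle term is the logarithm of the central binomial coefficient. The ratio of consecutive
    ones, [2 * (2 * n + 1) / (n + 1)], lies between 2 and 4. *)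
Lemma ln_central_fact n :
  n%:R * ln 2 <= ln ((n.*2)`!%:R : R) - 2 * ln n`!%:R <= n%:R * (2 * ln 2).
Proof.
elim: n => [|n]; first by rewrite fact0 ln1; lra.
have natp k : (k.+1%:R : R) \is Num.pos by rewrite posrE.
have factp k : (k`!%:R : R) \is Num.pos by rewrite posrE ltr0n fact_gt0.
rewrite doubleS !factS -doubleS !natrM !lnM ?rpredM // ?[_ \is _]natp //.
have -> : (n.+1.*2)%:R = 2 * n.+1%:R :> R by rewrite -mul2n natrM.
rewrite (lnM (natp 1%N) (natp n)).
have h1 : ln n.+1%:R <= ln n.*2.+1%:R :> R by rewrite ler_ln // ler_nat; lia.
have h2 : ln n.*2.+1%:R <= ln 2 + ln n.+1%:R :> R.
  rewrite -lnM // -natrM ler_ln ?posrE ?ltr0n // ler_nat; lia.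
move: h1 h2; move: (ln n.+1%:R) (ln n.*2.+1%:R) => a b h1 h2.
by rewrite -[n.+1%:R]natr1; lra.
Qed.

(** In Legendre's formula [d] gets the weight [n.*2 %/ d - 2 * (n %/ d)], which is 0 or 1, and is 1
    for [n < d <= n.*2]. *)
Lemma ln_central_psi n :
  ln (n.*2)`!%:R - 2 * ln n`!%:R <= psi n.*2 /\
  psi n.*2 - psi n <= ln (n.*2)`!%:R - 2 * ln n`!%:R.
Proof.
have nn : (n <= n.*2)%N by rewrite -addnn leq_addr.
rewrite (ln_fact (leqnn _)) (ln_fact nn) mulr_sumr -sumrB; split.
  apply: ler_sum_nat => d /andP[d1 dn].
  rewrite mulrCA -mulrBr ler_piMr ?vonMangoldt_ge0 // lerBlDl -natrM natr1.
  rewrite ler_nat -ltnS ltn_divLR //.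
  by have := ltn_ceil n d1; move: (n %/ d)%N => a; nia.
rewrite /psi (@big_cat_nat _ _ _ n.+1 1 n.*2.+1) //= ?ltnS //
  addrAC subrr add0r.
rewrite [leRHS](@big_cat_nat _ _ _ n.+1) //= ?ltnS //.
apply: ler_wpDl.
  rewrite big_nat sumr_ge0 // => d /andP[d1 _]; rewrite mulrCA -mulrBr.
  rewrite mulr_ge0 ?vonMangoldt_ge0 // subr_ge0 -natrM ler_nat leq_divRL //.
  by rewrite -muln2 [(2 * _)%N]mulnC mulnAC leq_mul2r orbC leq_divM.
apply: ler_sum_nat => d /andP[nd dn].
rewrite [(n %/ d)%N]divn_small // mulr0 mulr0 subr0.
by rewrite ler_peMr ?vonMangoldt_ge0 // ler1n divn_gt0 //; lia.
Qed.

Lemma psi_le n : psi n <= 4 * n%:R.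
Proof.
have [ln2l ln2u] := ln2_bounds.
elim/ltn_ind: n => -[|[|n]] IH; first by rewrite /psi big_geq // mulr0.
  have := sum_vonMangoldt_dvd R (ltn0Sn 0).
  by rewrite big_mkcond /psi !big_nat1 /= ln1 => ->; lra.
(* Induction by halving, rounded up: [psi k <= 4 * k] and the central binomial coefficient add up to
   at most [6 * k], and [3 * k <= 2 * n.+2]. *)
pose k := uphalf n.+2.
have kn : (k < n.+2)%N by rewrite /k; lia.
have nk : (n.+2 <= k.*2)%N by rewrite /k; lia.
have k3 : 3 * k%:R <= 2 * n.+2%:R :> R by rewrite -!natrM ler_nat /k; lia.
have := IH _ kn; have := le_psi nk; have [_] := ln_central_psi k.
have /andP[_ h] := ln_central_fact k.
have h' : k%:R * (2 * ln 2) <= 2 * k%:R :> R.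
  have : (0 : R) <= k%:R by []. nra.
lra.
Qed.

Lemma psi_ge n : (2 <= n)%N -> n%:R / 6 <= psi n.
Proof.
move=> n2; have [ln2l ln2u] := ln2_bounds.
pose k := n./2.
have kn : (k.*2 <= n)%N by rewrite /k; lia.
have k3 : n%:R <= 3 * k%:R :> R by rewrite -!natrM ler_nat /k; lia.
have := le_psi kn; have [+ _] := ln_central_psi k.
have /andP[h _] := ln_central_fact k.
have h' : k%:R * (1 / 2) <= k%:R * ln 2 :> R by rewrite ler_wpM2l.
lra.
Qed.
End Chebyshev.

(** * Rough and smooth integers *)

(** A [nat_pred], so that the theory of pi-parts applies. Smooth and rough integers both include 1
    and exclude 0. *)
Definition small (z : nat) : nat_pred := [pred q : nat | (q <= z)%N].
Definition smooth (z n : nat) := (small z).-nat n.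
Definition rough (z n : nat) := (small z)^'.-nat n.

Lemma rough_gt z n : rough z n -> (1 < n)%N -> (z < n)%N.
Proof.
move=> rn n1; have n0 := ltnW n1.
have := allP (proj2 (andP rn)) (pdiv n); rewrite pi_pdiv n1 => /(_ isT).
by rewrite !inE -ltnNge => /leq_trans -> //; exact: pdiv_leq.
Qed.

Lemma smooth_small z n : (0 < n <= z)%N -> smooth z n.
Proof.
move=> /andP[n0 nz]; apply/andP; split=> //; apply/allP => q.
rewrite mem_primes => /and3P[_ _ /(dvdn_leq n0) qn].
by rewrite inE (leq_trans qn).
Qed.

Section RoughSmooth.
Variable R : realType.
Implicit Types d m n s q z X Y K N : nat.

Definition harmonic_sum X : R := \sum_(1 <= n < X.+1) n%:R^-1.
Definition rough_sum z X : R := \sum_(1 <= m < X.+1 | rough z m) m%:R^-1.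
Definition smooth_sum z X : R := \sum_(1 <= s < X.+1 | smooth z s) s%:R^-1.

Lemma ln_harmonic_sum X : ln X.+1%:R <= harmonic_sum X.
Proof.
elim: X => [|X IH]; first by rewrite ln1 /harmonic_sum big_geq.
rewrite /harmonic_sum big_nat_recr //= -lerBlDr; apply: le_trans IH.
rewrite lerBlDr -lerBlDl -ln_div ?posrE //.
have -> : X.+2%:R / X.+1%:R = 1 + X.+1%:R^-1 :> R.
  by rewrite -[X.+2%:R]natr1 mulrDl divff ?mul1r // pnatr_eq0.
by apply: le_ln1Dx; apply: lt_trans (ltrN10 _) _; rewrite invr_gt0.
Qed.

Lemma harmonic_sum_le X : (0 < X)%N -> harmonic_sum X <= 1 + ln X%:R.
Proof.
elim: X => // -[|X] IH _; first by rewrite /harmonic_sum big_nat1 ln1 invr1;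
  lra.
rewrite /harmonic_sum big_nat_recr //=.
suff : X.+2%:R^-1 <= ln X.+2%:R - ln X.+1%:R :> R.
  by move=> h; apply: le_trans (lerD (IH isT) h) _;
    rewrite -addrA lerD2l addrCA subrr addr0.
rewrite -ln_div ?posrE // -lerN2 -lnV ?posrE ?divr_gt0 // invf_div.
have -> : X.+1%:R / X.+2%:R = 1 + - X.+2%:R^-1 :> R.
  by rewrite -[X.+1%:R](addrK 1) natr1 mulrBl divff ?mul1r // pnatr_eq0.
apply: le_ln1Dx; rewrite ltrN2 invf_lt1 //; last by rewrite ltr1n.
Qed.

(** The products [m * s] are distinct: [m] and [s] are the rough and the smooth part of the
    product. *)
Lemma rough_smooth_sum_le z X Y :
  rough_sum z X * smooth_sum z Y <= harmonic_sum (X * Y).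
Proof.
rewrite /rough_sum /smooth_sum big_distrlr /= sum_pair_seq.
apply: (@ler_sum_inj _ _ _ _ _ _ _ (fun x => x.1 * x.2)%N).
- by apply: allpairs_uniq; rewrite ?iota_uniq // => -[? ?] [? ?].
- exact: iota_uniq.
- move=> _ /allpairsP[[m s] /= [+ + ->]] /= _; rewrite !mem_index_iota !ltnS.
  move=> /andP[m0 mX] /andP[s0 sY]; split => //.
    by rewrite muln_gt0 m0 s0 leq_mul.
  by rewrite natrM invfM.
- move=> [m s] [m' s'] _ /= /andP[rm ss] _ /andP[rm' ss'] e.
  have dec u v : rough z u -> smooth z v ->
      ((u * v)`_(small z) = v)%N /\ ((u * v)`_((small z)^') = u)%N.
    move=> ru sv; have u0 : (0 < u)%N by case/andP: ru.
    have v0 : (0 < v)%N by case/andP: sv.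
    rewrite !partnM // (part_p'nat ru) (part_pnat_id sv) (part_pnat_id ru).
    by rewrite mul1n part_p'nat ?muln1 // pnatNK.
  have [e1 e2] := dec _ _ rm ss; have [e1' e2'] := dec _ _ rm' ss'.
  by move: e1 e2; rewrite e e1' e2' => -> ->.
- by move=> j; rewrite invr_ge0.
Qed.

(** Each [n <= X] is the product of its rough and smooth parts, both at most [X]. *)
Lemma le_rough_smooth_sum z X : harmonic_sum X <=
  rough_sum z X * smooth_sum z X.
Proof.
rewrite /rough_sum /smooth_sum big_distrlr /= sum_pair_seq.
apply: (@ler_sum_inj _ _ _ _ _ _ _ (fun n =>
  (n`_((small z)^'), n`_(small z))%N)).
- exact: iota_uniq.
- by apply: allpairs_uniq; rewrite ?iota_uniq // => -[? ?] [? ?].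
- move=> n; rewrite mem_index_iota => /andP[n0 nX] _ /=; split.
  + apply: allpairs_f; rewrite mem_index_iota part_gt0 /=;
      exact: leq_ltn_trans (dvdn_leq n0 (dvdn_part _ _)) nX.
  + by rewrite /rough /smooth !part_pnat.
  + by rewrite -invfM -natrM mulnC partnC.
- move=> n n'; rewrite !mem_index_iota => /andP[n0 _] _ /andP[n'0 _] _ [e1 e2].
  by rewrite -(partnC (small z) n0) e1 e2 partnC.
- by move=> x; rewrite mulr_ge0 // invr_ge0.
Qed.

Lemma smooth_sum_small z : smooth_sum z z = harmonic_sum z.
Proof.
rewrite /smooth_sum /harmonic_sum big_nat_cond [RHS]big_nat_cond.
apply: eq_bigl => s; rewrite ltnS andbT; case: (boolP (0 < s <= z)%N) => //= sz.
exact: smooth_small.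
Qed.

Lemma rough_sum_ge0 z X : 0 <= rough_sum z X.
Proof. by apply: sumr_ge0 => m _; rewrite invr_ge0. Qed.

Lemma smooth_sum_ge0 z X : 0 <= smooth_sum z X.
Proof. by apply: sumr_ge0 => m _; rewrite invr_ge0. Qed.

Lemma ln_ge_half X : (1 < X)%N -> 1 / 2 <= ln X%:R :> R.
Proof.
move=> X1; have [+ _] := ln2_bounds R; move=> /le_trans -> //.
by rewrite ler_ln ?posrE ?ltr0n ?ler_nat //; lia.
Qed.

(** Multiply by the smooth sum up to [z], which is the full harmonic sum and so at least [ln z]. The
    product is at most [1 + ln X + ln z <= 4 * ln X], as [ln X >= 1 / 2]. *)
Lemma rough_sum_le z X : (1 < z <= X)%N ->
  rough_sum z X <= 4 * ln X%:R / ln z%:R.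
Proof.
move=> /andP[z1 zX]; have X1 := leq_trans z1 zX.
have hz := ln_ge_half z1; have hX := ln_ge_half X1.
have lzX : ln z%:R <= ln X%:R :> R.
  by rewrite ler_ln ?posrE ?ltr0n ?ler_nat //; lia.
rewrite ler_pdivlMr; last by lra.
have h1 := rough_smooth_sum_le z X z; rewrite smooth_sum_small in h1.
have h2 : ln z%:R <= harmonic_sum z.
  apply: le_trans (ln_harmonic_sum z); rewrite ler_ln ?posrE ?ltr0n ?ler_nat //.
  by lia.
have h3 := ler_wpM2l (rough_sum_ge0 z X) h2.
have h4 : harmonic_sum (X * z) <= 1 + (ln X%:R + ln z%:R).
  rewrite -lnM ?posrE ?ltr0n -?natrM ?harmonic_sum_le ?muln_gt0 //; lia.
lra.
Qed.
End RoughSmooth.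

(** * Upper bound for the smooth sum *)

Section SmoothSum.
Variable R : realType.
Implicit Types d m n s q z X Y K N : nat.

Lemma vonMangoldt_prime q : prime q -> ln q%:R <= vonMangoldt R q.
Proof.
move=> pq; rewrite /vonMangoldt big_mkcond big_nat_recr ?prime_gt0 //= pq.
apply: ler_wpDl.
  apply: sumr_ge0 => i _; case: ifP => // _.
  by apply: sumr_ge0 => k _; exact: ln_nat_ge0.
have q1 := prime_gt1 pq.
rewrite big_mkcond big_ltn ?ltnS ?prime_gt0 // expn1 eqxx lerDl.
by apply: sumr_ge0 => k _; case: ifP => // _; exact: ln_nat_ge0.
Qed.

(** A Mertens bound from [ln z! <= z * ln z]; rounding [z / q] down loses at most a factor 2. *)
Lemma sum_ln_prime_div z : (0 < z)%N ->
  \sum_(1 <= q < z.+1 | prime q) ln q%:R / q%:R <= 2 * ln z%:R :> R.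
Proof.
move=> z0; have zR : 0 < z%:R :> R by rewrite ltr0n.
rewrite -(ler_pM2l zR); apply: (@le_trans _ _ (2 * ln z`!%:R)).
  rewrite (ln_fact R (leqnn z)) !mulr_sumr big_mkcond; apply: ler_sum_nat => d.
  rewrite ltnS => /andP[d0 dz]; have dR : 0 < d%:R :> R by rewrite ltr0n.
  have h : z%:R / d%:R <= 2 * (z %/ d)%:R :> R.
    rewrite ler_pdivrMr // -!natrM ler_nat.
    have := ltn_ceil z d0; have : (0 < z %/ d)%N by rewrite divn_gt0.
    by move: (z %/ d)%N => a; nia.
  case: ifPn => pd; last by rewrite !mulr_ge0 // vonMangoldt_ge0.
  rewrite mulrCA [leRHS]mulrCA ler_pM ?ln_nat_ge0 ?divr_ge0 //.
  exact: vonMangoldt_prime.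
rewrite mulrCA ler_pM2l // fact_prod big_nat ln_prod_nat => [|i /andP[]//].
rewrite -big_nat; apply: (@le_trans _ _ (\sum_(1 <= i < z.+1) ln z%:R)).
  apply: ler_sum_nat => i /andP[i0 iz].
  by rewrite ler_ln ?posrE ?ltr0n // ler_nat.
by rewrite sumr_const_nat subSS subn0 mulr_natl.
Qed.

(** Removing one factor [q] from each multiple of [q] gives [T <= (S + T) / q], where [T] is the
    left side and [S] the smooth sum. Hence [T <= S / (q - 1) <= 2 * S / q]. *)
Lemma sum_logn_smooth z q X : prime q -> (q <= z)%N ->
  \sum_(1 <= s < X.+1 | smooth z s) (logn q s)%:R / s%:R <=
  2 / q%:R * smooth_sum R z X.
Proof.
move=> pq qz; have q0 := prime_gt0 pq.
set T := (X in X <= _).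
have qR : 0 < q%:R :> R by rewrite ltr0n.
have q2 : 2 <= q%:R :> R by rewrite ler_nat prime_gt1.
suff h : T <= q%:R^-1 * (smooth_sum R z X + T).
  have h' : q%:R * T <= smooth_sum R z X + T by rewrite -ler_pdivlMl.
  have T0 : 0 <= T by apply: sumr_ge0 => s _; rewrite divr_ge0.
  rewrite -mulrA mulrCA ler_pdivlMl //; nra.
pose G m : R := if smooth z m then (q%:R^-1 * ((1 + (logn q m)%:R) / m%:R))
  else 0.
have TE : T = \sum_(1 <= s < X.+1 | (q %| s)%N) G (s %/ q)%N.
  rewrite /T big_mkcond [RHS]big_mkcond; apply: eq_big_nat => s /andP[s0 _].
  have [/dvdnP[m sE]|qs] := boolP (q %| s)%N; last first.
    by rewrite lognE (negbTE qs) !andbF mul0r if_same.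
  have m0 : (0 < m)%N by move: s0; rewrite sE muln_gt0 => /andP[].
  have -> : smooth z s = smooth z m.
    have qsm : (small z).-nat q by rewrite pnatE //; exact: qz.
    by rewrite sE /smooth pnatM qsm andbT.
  rewrite sE mulnK // /G; case: ifP => // _.
  rewrite lognM // (@pfactorK q 1) // addn1 natrM -natr1 invfM addrC.
  by rewrite [RHS]mulrA [q%:R^-1 * _]mulrC -mulrA [q%:R^-1 * _]mulrC.
rewrite [leLHS]TE sum_dvd_div // mulrDr /T /smooth_sum !mulr_sumr -big_split /=.
rewrite /G -big_mkcond; apply: (@ler_sum_inj _ _ _ _ _ _ _ id).
- exact: iota_uniq.
- exact: iota_uniq.
- move=> m; rewrite !mem_index_iota ltnS => /andP[-> mX] sm; split=> //=.
    by rewrite ltnS (leq_trans mX) // leq_div.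
  by rewrite mulrDl mul1r mulrDr.
- by [].
- by move=> m; rewrite -mulrDr !mulr_ge0 ?addr_ge0 ?divr_ge0 ?invr_ge0.
Qed.

(** Expand [ln s] over the primes dividing [s], all at most [z], and insert the two preceding
    bounds. *)
Lemma sum_ln_smooth z X : (0 < z <= X)%N ->
  \sum_(1 <= s < X.+1 | smooth z s) ln s%:R / s%:R <=
  4 * ln z%:R * smooth_sum R z X.
Proof.
move=> /andP[z0 zX].
have -> : \sum_(1 <= s < X.+1 | smooth z s) ln s%:R / s%:R =
    \sum_(1 <= q < X.+1 | prime q)
      ln q%:R * \sum_(1 <= s < X.+1 | smooth z s) (logn q s)%:R / s%:R :> R.
  under [RHS]eq_bigr => q _ do rewrite mulr_sumr.
  rewrite [RHS]exchange_big /=; apply: congr_big_nat => // s.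
  rewrite ltnS => /andP[_ sX]; rewrite (ln_prime_decomp R sX) mulr_suml.
  by apply: eq_bigr => q _; rewrite mulrA [ln _ * _]mulrC.
apply: (@le_trans _ _ (\sum_(1 <= q < X.+1 | prime q && (q <= z)%N)
    ln q%:R / q%:R * (2 * smooth_sum R z X))).
  rewrite big_mkcondr; apply: ler_sum => q pq; case: ifPn => qz.
    rewrite -[leRHS]mulrA ler_wpM2l ?ln_nat_ge0 // mulrCA mulrA.
    exact: sum_logn_smooth.
  rewrite big1 ?mulr0 // => s ss; rewrite lognE; case: ifP; rewrite ?mul0r //.
  move=> /and3P[_ s0 qs]; case/negP: qz; have := allP (proj2 (andP ss)) q.
  by rewrite mem_primes pq s0 qs => /(_ isT).
rewrite -mulr_suml.
rewrite [leRHS](_ : _ = 2 * ln z%:R * (2 * smooth_sum R z X)); last by ring.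
rewrite ler_wpM2r ?mulr_ge0 ?smooth_sum_ge0 //.
apply: le_trans (sum_ln_prime_div z0).
by rewrite [leRHS](@big_nat_widen _ _ _ _ _ X.+1).
Qed.

(* By [sum_ln_smooth] the average of [ln s] for the weights [1 / s] is at most
   [4 * ln z], so half of the mass lies on [s <= z ^ 8] (Markov). *)
Lemma smooth_sum_le z X : (1 < z <= X)%N ->
  smooth_sum R z X <= 20 * ln z%:R.
Proof.
move=> /andP[z1 zX]; have hz := ln_ge_half R z1.
have hsum : smooth_sum R z X <= harmonic_sum R (z ^ 8) + smooth_sum R z X / 2.
  rewrite {1}/smooth_sum (bigID (fun s => s <= z ^ 8)%N) /= lerD //.
    apply: (@ler_sum_inj _ _ _ _ _ _ _ id) => //; rewrite ?iota_uniq //.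
    move=> s; rewrite !mem_index_iota => /andP[-> _] /andP[_ sz]; split => //=.
  have h := @sum_ln_smooth z X; rewrite (ltnW z1) zX in h; have {}h := h isT.
  rewrite -(@ler_pM2l _ (8 * ln z%:R)); last by lra.
  apply: (@le_trans _ _ (4 * ln z%:R * smooth_sum R z X)); last by lra.
  apply: le_trans h; rewrite mulr_sumr big_mkcondr; apply: ler_sum => s ss.
  case: ifPn => [|_]; last by rewrite divr_ge0 ?ln_nat_ge0.
  rewrite -ltnNge => zs; rewrite ler_wpM2r ?invr_ge0 //.
  rewrite mulr_natl -lnXn ?ltr0n ?(ltnW z1) // -natrX ler_ln ?posrE ?ltr0n.
  - by rewrite ler_nat ltnW.
  - by rewrite expn_gt0 (ltnW z1).
  - exact: leq_ltn_trans zs.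
(* The smooth sum is thus at most [2 * (1 + 8 * ln z)], and [1 <= 2 * ln z] yields the constant
   20. *)
have := @harmonic_sum_le R (z ^ 8); rewrite expn_gt0 (ltnW z1) => /(_ isT).
rewrite natrX lnXn ?ltr0n ?(ltnW z1) // -[_ *+ 8]mulr_natl => h.
lra.
Qed.

Lemma rough_sum_ge z X : (1 < z <= X)%N ->
  ln X%:R / (20 * ln z%:R) <= rough_sum R z X.
Proof.
move=> zX; have /andP[z1 zX'] := zX; have hz := ln_ge_half R z1.
have h := smooth_sum_le zX; rewrite ler_pdivrMr; last by lra.
apply: le_trans (ler_wpM2l (rough_sum_ge0 R z X) h).
apply: le_trans (le_rough_smooth_sum R z X).
apply: le_trans (ln_harmonic_sum R X).
by rewrite ler_ln ?posrE ?ltr0n ?ler_nat //; lia.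
Qed.
End SmoothSum.

Lemma roughM z m n : rough z (m * n) = rough z m && rough z n.
Proof. exact: pnatM. Qed.

Lemma rough_gt0 z n : rough z n -> (0 < n)%N.
Proof. by case/andP. Qed.

(** * Counting rough integers *)

Section RoughCount.
Variable R : realType.
Implicit Types d m n q k z y X K N M : nat.

Definition rough_count z X : R := \sum_(1 <= n < X.+1 | rough z n) 1.

(** A product is rough exactly when both factors are, so the condition splits between [m] and
    [d]. *)
Lemma sum_ln_rough z X :
  \sum_(1 <= n < X.+1 | rough z n) ln n%:R =
  \sum_(1 <= m < X.+1 | rough z m)
    \sum_(1 <= d < (X %/ m).+1 | rough z d) vonMangoldt R d.
Proof.
rewrite sum_ln (exchange_big_dep predT) //= [RHS]big_mkcond.
apply: congr_big_nat => // m; rewrite ltnS => /andP[_ /andP[m0 mX]].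
case: ifPn => rm; last first.
  by rewrite big_pred0 // => d; rewrite roughM (negbTE rm) !andbF.
rewrite [RHS](@big_nat_widen _ _ _ _ _ X.+1) ?ltnS ?leq_div //.
by apply: eq_bigl => d; rewrite roughM rm andbT andbC ltnS leq_divRL.
Qed.

Lemma ln_sqrt (a : R) : 0 < a -> ln a = 2 * ln (Num.sqrt a).
Proof.
move=> a0; rewrite -[in LHS](sqr_sqrtr (ltW a0)) lnXn ?sqrtr_gt0 //.
by rewrite mulr_natl.
Qed.

(** Rough integers up to the square root of [K] are few. For the others [ln n >= ln K / 2], while
    the sum of [ln n] over all rough [n <= K] is at most [4 * K] times the rough sum. *)
Lemma rough_count_le z K : (1 < z <= K)%N ->
  rough_count z K <= 34 * K%:R / ln z%:R.
Proof.
move=> zK; have /andP[z1 zK'] := zK; have K1 := leq_trans z1 zK'.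
have hz := ln_ge_half R z1; have hK := ln_ge_half R K1.
have K0 : 0 < K%:R :> R by rewrite ltr0n ltnW.
have zKln : ln z%:R <= ln K%:R :> R.
  by rewrite ler_ln ?posrE ?ltr0n ?ler_nat //; lia.
have sK0 : 0 < Num.sqrt K%:R :> R by rewrite sqrtr_gt0.
have sK2 : Num.sqrt K%:R * Num.sqrt K%:R = K%:R :> R.
  by rewrite -expr2 sqr_sqrtr // ltW.
(* The count is at most [sqrt K], and [ln z <= ln K = 2 * ln (sqrt K) <= 2 * sqrt K]. *)
have hsmall : \sum_(1 <= n < K.+1 | rough z n && (n ^ 2 <= K)%N) 1 <=
    2 * K%:R / ln z%:R :> R.
  apply: (@le_trans _ _ (Num.sqrt K%:R)).
    set t := Num.trunc (Num.sqrt K%:R : R).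
    apply: (@le_trans _ _ (\sum_(1 <= n < t.+1) 1)).
      apply: (@ler_sum_inj _ _ _ _ _ _ _ id); rewrite ?iota_uniq //.
      move=> n; rewrite !mem_index_iota => /andP[n0 _] /andP[_ nK]; split => //.
      rewrite n0 ltnS /t truncn_ge_nat; last exact: ltW.
      by rewrite /= -ler_sqr ?nnegrE // [leRHS]expr2 sK2 -natrX ler_nat.
    by rewrite sumr_const_nat subSS subn0 truncn_le ltW.
  rewrite ler_pdivlMr; last by lra.
  apply: (@le_trans _ _ (Num.sqrt K%:R * ln K%:R)); first by rewrite ler_pM2l.
  rewrite (ln_sqrt K0) mulrCA ler_pM2l // -[leRHS]sK2 ler_pM2l //.
  exact/ltW/ln_sublinear.
(* The constant is [2 * 4 * 4], from halving [ln K], from [psi_le] and from [rough_sum_le]. *)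
have hlarge : \sum_(1 <= n < K.+1 | rough z n && ~~ (n ^ 2 <= K)%N) 1 <=
    32 * K%:R / ln z%:R :> R.
  rewrite ler_pdivlMr; last by lra.
  have h : ln K%:R / 2 * \sum_(1 <= n < K.+1 | rough z n && ~~ (n ^ 2 <= K)%N) 1
      <= \sum_(1 <= n < K.+1 | rough z n) ln n%:R :> R.
    rewrite mulr_sumr big_mkcondr; apply: ler_sum => n rn.
    case: ifPn => [|_]; last exact: ln_nat_ge0.
    rewrite -ltnNge mulr1 => Kn; rewrite ler_pdivrMr // mulr_natr.
    have n0 := rough_gt0 rn.
    rewrite -lnXn ?ltr0n // -natrX ler_ln ?posrE ?ltr0n ?expn_gt0 ?n0 //.
      by rewrite ler_nat ltnW.
    exact: ltnW.
  have h2 : \sum_(1 <= n < K.+1 | rough z n) ln n%:R <=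
      4 * K%:R * rough_sum R z K.
    rewrite sum_ln_rough mulr_sumr; apply: ler_sum => m rm.
    have m0 : 0 < m%:R :> R by rewrite ltr0n (rough_gt0 rm).
    apply: (@le_trans _ _ (psi R (K %/ m))).
      rewrite /psi [leRHS](bigID (rough z)) /= lerDl.
      by apply: sumr_ge0 => d _; exact: vonMangoldt_ge0.
    apply: le_trans (psi_le R _) _; rewrite -mulrA ler_pM2l //.
    by rewrite ler_pdivlMr // -natrM ler_nat leq_divM.
  have h3 := rough_sum_le R zK; rewrite ler_pdivlMr in h3; last by lra.
  set A := \sum_(_ <= _ < _ | _) _ in h *.
  have h4 : ln K%:R / 2 * A <=
    4 * K%:R * rough_sum R z K by apply: le_trans h h2.
  have h5 : 4 * K%:R * (rough_sum R z K * ln z%:R) <= 4 * K%:R * (4 * ln K%:R).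
    by rewrite ler_wpM2l // mulr_ge0 // ltW.
  have h6 := ler_wpM2r (_ : 0 <= ln z%:R) h4.
  have lz0 : 0 <= ln z%:R :> R by lra.
  have lK0 : 0 < ln K%:R :> R by lra.
  rewrite -(ler_pM2l lK0); have := h6 lz0; lra.
rewrite /rough_count (bigID (fun n => n ^ 2 <= K)%N) /=.
have -> : 34 * K%:R / ln z%:R = 2 * K%:R / ln z%:R + 32 * K%:R / ln z%:R :> R.
  by rewrite -!mulrDl; congr (_ / _); ring.
exact: lerD.
Qed.

(** Only powers of primes [q <= z] contribute, and those of one [q] give at most
    [trunc_log q y * ln q <= ln y]. *)
Lemma sum_vonMangoldt_not_rough z y : (0 < y)%N ->
  \sum_(1 <= d < y.+1 | ~~ rough z d) vonMangoldt R d <= z%:R * ln y%:R.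
Proof.
move=> y0; rewrite sum_vonMangoldt.
apply: (@le_trans _ _ (\sum_(1 <= q < z.+1) ln y%:R)); last first.
  by rewrite sumr_const_nat subSS subn0 mulr_natl.
apply: (@le_trans _ _ (\sum_(1 <= q < y.+1 | prime q && (q <= z)%N) ln y%:R)).
  rewrite big_mkcondr; apply: ler_sum => q pq; case: ifPn => qz; last first.
    have rq : rough z q by rewrite /rough pnatE.
    by rewrite big_pred0 // => k; rewrite /rough pnatX [_.-nat q]rq.
  have q1 := prime_gt1 pq.
  apply: (@le_trans _ _ (\sum_(1 <= k < (trunc_log q y).+1) ln q%:R)).
    apply: (@ler_sum_inj _ _ _ _ _ _ _ id); rewrite ?iota_uniq //.
      move=> k; rewrite !mem_index_iota => /andP[k0 _] /andP[_ ky];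
        split => //=.
      by rewrite k0 ltnS trunc_log_max.
    by move=> _; exact: ln_nat_ge0.
  have /andP[h _] := trunc_log_bounds q1 y0.
  rewrite sumr_const_nat subSS subn0 -lnXn ?ltr0n ?prime_gt0 // -natrX.
  by rewrite ler_ln ?posrE ?ltr0n ?expn_gt0 ?(ltnW q1) // ler_nat.
apply: (@ler_sum_inj _ _ _ _ _ _ _ id); rewrite ?iota_uniq //.
  by move=> q; rewrite !mem_index_iota => /andP[-> _] /andP[_ qz]; split.
by move=> _; exact: ln_nat_ge0.
Qed.

(** Half of the lower bound [y / 6] for [psi y] survives the removal of the [d] that are not
    rough. *)
Lemma sum_vonMangoldt_rough_ge z y : (6 < z)%N -> (z ^ 4 <= y)%N ->
  y%:R / 12 <= \sum_(1 <= d < y.+1 | rough z d) vonMangoldt R d.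
Proof.
move=> z6 zy; have z4 : (z <= z ^ 4)%N by rewrite -{1}(expn1 z) leq_pexp2l //;
  lia.
have y2 : (2 <= y)%N by lia.
have y0 : 0 < y%:R :> R by rewrite ltr0n; lia.
have h := psi_ge R y2; rewrite /psi (bigID (rough z)) /= in h.
have h2 := @sum_vonMangoldt_not_rough z y (ltnW y2).
suff : z%:R * ln y%:R <= y%:R / 12 :> R by lra.
(* With [u] the fourth root of [y], [z <= u] and [ln y = 4 * ln u <= 4 * u]. It remains to see
   [4 * u ^ 2 <= u ^ 4 / 12], that is [u ^ 2 >= 48], which follows from [u >= z >= 7]. *)
set u : R := Num.sqrt (Num.sqrt y%:R).
have v0 : 0 < Num.sqrt y%:R :> R by rewrite sqrtr_gt0.
have u0 : 0 < u by rewrite sqrtr_gt0.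
have u2 : u ^+ 2 = Num.sqrt y%:R by rewrite sqr_sqrtr // ltW.
have u4 : u ^+ 4 = y%:R by rewrite (exprM u 2 2) u2 sqr_sqrtr // ltW.
have zu : z%:R <= u.
  by rewrite -(@ler_pXn2r _ 4) ?nnegrE ?(ltW u0) // u4 -natrX ler_nat.
have u7 : 7 <= u by apply: le_trans zu; rewrite ler_nat.
rewrite (ln_sqrt y0) (ln_sqrt v0) -/u.
have lu : ln u <= u by apply/ltW/ln_sublinear.
have : z%:R * (2 * (2 * ln u)) <= u * (4 * u).
  apply: (@le_trans _ _ (z%:R * (4 * u))); first by rewrite ler_wpM2l //; lra.
  by rewrite ler_wpM2r // mulr_ge0 // ltW.
move=> /le_trans; apply; rewrite -u4.
have : 48 * u ^+ 2 <= u ^+ 2 * u ^+ 2.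
  by rewrite ler_wpM2r ?sqr_ge0 //; nra.
rewrite -exprD expr2; lra.
Qed.

(** The count times [ln N] dominates the sum of [ln n] over rough [n <= N]. In [sum_ln_rough] each
    [m <= N %/ z ^ 4] has an inner sum of at least [N / (24 * m)], and [rough_sum_ge] applies to
    these [m]. The constant is [24 * 20 * 2], the 2 coming from [ln M >= ln N / 2]. *)
Lemma rough_count_ge z N : (6 < z)%N -> (z ^ 10 <= N)%N ->
  N%:R / (960 * ln z%:R) <= rough_count z N.
Proof.
move=> z6 zN; have z1 : (1 < z)%N by lia.
have hz := ln_ge_half R z1.
have z40 : (0 < z ^ 4)%N by rewrite expn_gt0; lia.
set M := (N %/ z ^ 4)%N.
have hM : (M * z ^ 4 <= N)%N by rewrite leq_divM.
have hM' : (N < M.+1 * z ^ 4)%N by rewrite ltn_ceil.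
have z10 : (z ^ 10 = z ^ 4 * z ^ 4 * z ^ 2)%N by rewrite -!expnD.
have z2 : (4 <= z ^ 2)%N by rewrite expnS expn1; nia.
have M0 : (0 < M)%N.
  by rewrite divn_gt0 //; apply: leq_trans zN; rewrite leq_pexp2l //; lia.
(* Combine [N <= 2 * M * z ^ 4], squared, with [4 * z ^ 8 <= z ^ 10 <= N]. *)
have MN : (N <= M ^ 2)%N.
  have a1 : (N <= 2 * M * z ^ 4)%N by nia.
  have a2 : (N * N <= 4 * (M * M) * (z ^ 4 * z ^ 4))%N by nia.
  have a3 : (4 * (z ^ 4 * z ^ 4) <= N)%N by nia.
  have a4 : (0 < z ^ 4 * z ^ 4)%N by rewrite muln_gt0 z40.
  rewrite expnS expn1; nia.
have zM : (z <= M)%N.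
  have : (z ^ 2 <= M ^ 2)%N.
    by apply: leq_trans MN; apply: leq_trans zN; rewrite leq_pexp2l //; lia.
  by rewrite leq_exp2r.
have N1 : (1 < N)%N.
  by apply: leq_trans zN; apply: leq_trans z1 _;
    rewrite -{1}(expn1 z) leq_pexp2l //; lia.
have hN := ln_ge_half R N1.
have hlnM : ln N%:R / 2 <= ln M%:R :> R.
  rewrite ler_pdivrMr // mulr_natr -lnXn ?ltr0n // -natrX.
  by rewrite ler_ln ?posrE ?ltr0n ?expn_gt0 ?M0 // ?ler_nat //; lia.
have h1 : \sum_(1 <= n < N.+1 | rough z n) ln n%:R <= rough_count z N * ln N%:R.
  rewrite /rough_count mulr_suml big_nat_cond [leRHS]big_nat_cond.
  apply: ler_sum => n /andP[/andP[n0 nN] _].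
  by rewrite mul1r ler_ln ?posrE ?ltr0n // ?ler_nat //; lia.
have h2 : N%:R / 24 * rough_sum R z M <= \sum_(1 <=
  n < N.+1 | rough z n) ln n%:R.
  rewrite sum_ln_rough mulr_sumr.
  apply: (@le_trans _ _ (\sum_(1 <= m < M.+1 | rough z m)
      \sum_(1 <= d < (N %/ m).+1 | rough z d) vonMangoldt R d)); last first.
    apply: (@ler_sum_inj _ _ _ _ _ _ _ id); rewrite ?iota_uniq //.
      move=> m; rewrite !mem_index_iota !ltnS => /andP[-> mM] rm; split => //=.
      by apply: leq_trans mM _; rewrite leq_div.
    by move=> m; apply: sumr_ge0 => d _; exact: vonMangoldt_ge0.
  rewrite big_nat_cond [leRHS]big_nat_cond; apply: ler_sum => m.
  rewrite ltnS => /andP[/andP[m0 mM] rm].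
  have m0' : 0 < m%:R :> R by rewrite ltr0n.
  have hy : (z ^ 4 <= N %/ m)%N by rewrite leq_divRL //; nia.
  apply: le_trans (sum_vonMangoldt_rough_ge z6 hy).
  have : N%:R <= 2 * (N %/ m)%:R * m%:R :> R.
    rewrite -!natrM ler_nat; have := ltn_ceil N m0; move: hy.
    by move: (N %/ m)%N => a; nia.
  rewrite -ler_pdivrMr // => hh.
  by rewrite mulrAC; lra.
have h3 := @rough_sum_ge R z M; rewrite z1 zM in h3; have {}h3 := h3 isT.
rewrite ler_pdivrMr in h3; last by lra.
rewrite ler_pdivrMr; last by lra.
have lN0 : 0 < ln N%:R :> R by lra.
rewrite -(ler_pM2r lN0).
have lz0 : 0 <= ln z%:R :> R by lra.
have h4 := ler_wpM2r lz0 (le_trans h2 h1).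
have h5 : N%:R / 24 * ln M%:R <= N%:R / 24 * (rough_sum R z M * (20 * ln z%:R)).
  by rewrite ler_wpM2l // divr_ge0.
have h6 : N%:R / 24 * (ln N%:R / 2) <= N%:R / 24 * ln M%:R :> R.
  by rewrite ler_wpM2l // divr_ge0.
lra.
Qed.
End RoughCount.

(** * The gcd sum over rough integers *)

Section GcdSum.
Variable R : realType.
Implicit Types d m n q k z N g : nat.

(** The summand is the smaller of [gcd / m] and [gcd / n], the two bounds that counting collisions
    provides. *)
Definition gcd_sum z N : R :=
  \sum_(1 <= m < N.+1 | rough z m) \sum_(1 <= n < N.+1 | rough z n)
    (gcdn m n)%:R / (maxn m n)%:R.

Lemma gcd_sum_half z N :
  gcd_sum z N <=
  2 * \sum_(1 <= m < N.+1 | rough z m)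
        \sum_(1 <= n < N.+1 | rough z n && (n <= m)%N) (gcdn m n)%:R / m%:R.
Proof.
set U := \sum_(1 <= m < _ | _) _.
have -> : 2 * U = U + \sum_(1 <= m < N.+1 | rough z m)
    \sum_(1 <= n < N.+1 | rough z n && (m <= n)%N) (gcdn m n)%:R / n%:R.
  rewrite mulr_natl mulr2n; congr (_ + _); rewrite /U.
  rewrite (exchange_big_dep (rough z)) /=; last by move=> m n _ /andP[].
  apply: eq_bigr => n rn; apply: eq_big => m; first by rewrite rn.
  by move=> _; rewrite gcdnC.
rewrite /gcd_sum /U -big_split /=; apply: ler_sum => m rm.
rewrite (bigID (fun n => n <= m)%N) /= lerD //.
  by apply: ler_sum => n /andP[_ nm]; rewrite (maxn_idPl nm).
rewrite big_mkcondr [leRHS]big_mkcondr; apply: ler_sum => n rn.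
case: leqP => [nm|mn]; first by case: ifP => // _; rewrite divr_ge0.
by rewrite (ltnW mn).
Qed.

(** Put [m = g * k] and [n = g * j] with [g] the gcd, so that [g / m = 1 / k] and [j <= k]; the
    coprimality of [j] and [k] is dropped. *)
Lemma gcd_sum_half_le z N :
  \sum_(1 <= m < N.+1 | rough z m)
     \sum_(1 <= n < N.+1 | rough z n && (n <= m)%N) (gcdn m n)%:R / m%:R <=
  \sum_(1 <= g < N.+1 | rough z g) \sum_(1 <= k < (N %/ g).+1 | rough z k)
     rough_count R z k / k%:R.
Proof.
have -> : \sum_(1 <= g < N.+1 | rough z g)
     \sum_(1 <= k < (N %/ g).+1 | rough z k) rough_count R z k / k%:R =
  \sum_(1 <= g < N.+1 | rough z g)
   \sum_(1 <= k < N.+1 | rough z k && (g * k <= N)%N)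
    \sum_(1 <= j < N.+1 | rough z j && (j <= k)%N) k%:R^-1 :> R.
  apply: congr_big_nat => // g; rewrite ltnS => /andP[_ /andP[g0 gN]].
  rewrite (@big_nat_widen _ _ _ _ _ N.+1) ?ltnS ?leq_div //.
  apply: congr_big_nat => // k; rewrite ltnS.
    by move=> _; rewrite ltnS leq_divRL // mulnC.
  move=> /andP[_ /andP[k0 kN]].
  rewrite /rough_count mulr_suml (@big_nat_widen _ _ _ _ _ N.+1) ?ltnS //.
  by apply: eq_bigr => j _; rewrite mul1r.
under [leRHS]eq_bigr => g _ do rewrite sum_pair_seq.
rewrite !sum_pair_seq.
pose f (x : nat * nat) :=
  (gcdn x.1 x.2, (x.1 %/ gcdn x.1 x.2, x.2 %/ gcdn x.1 x.2))%N.
have uq (I J : eqType) (r : seq I) (s : seq J) : uniq r -> uniq s ->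
    uniq [seq (i, j) | i <- r, j <- s].
  by move=> ur us; apply: allpairs_uniq => // -[? ?] [? ?].
apply: (@ler_sum_inj _ _ _ _ _ _ _ f).
- by rewrite uq ?iota_uniq.
- by rewrite !uq ?iota_uniq.
- move=> _ /allpairsP[[m n] /= [+ + ->]] /=; rewrite !mem_index_iota !ltnS.
  move=> /andP[m0 mN] /andP[n0 nN] /and3P[rm rn nm].
  set g := gcdn m n.
  have g0 : (0 < g)%N by rewrite gcdn_gt0 m0.
  have gm : (g * (m %/ g) = m)%N by rewrite mulnC divnK // dvdn_gcdl.
  have gn : (g * (n %/ g) = n)%N by rewrite mulnC divnK // dvdn_gcdr.
  move: rm rn; rewrite -{1}gm -{1}gn !roughM => /andP[rg rk] /andP[_ rj].
  split.
  + apply: allpairs_f.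
      by rewrite mem_index_iota g0 ltnS (leq_trans _ mN) // dvdn_leq //
        dvdn_gcdl.
    apply: allpairs_f; rewrite mem_index_iota ltnS.
    * by rewrite (rough_gt0 rk) (leq_trans _ mN) // leq_div.
    * by rewrite (rough_gt0 rj) (leq_trans _ nN) // leq_div.
  + by rewrite rg rk rj gm mN /= leq_div2r.
  + rewrite ler_pdivrMr ?ltr0n // mulrC ler_pdivlMr ?ltr0n ?(rough_gt0 rk) //.
    by rewrite -natrM ler_nat gm.
- move=> [m n] [m' n'] _ _ _ _ [eg e1 e2].
  have h a b c : (c %| a)%N -> (c %| b)%N -> (a %/ c = b %/ c)%N -> a = b.
    by move=> ca cb e; rewrite -(divnK ca) -(divnK cb) e.
  congr (_, _); apply: (h _ _ (gcdn m n)).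
  + exact: dvdn_gcdl.
  + by rewrite eg dvdn_gcdl.
  + by rewrite e1 -eg.
  + exact: dvdn_gcdr.
  + by rewrite eg dvdn_gcdr.
  + by rewrite e2 -eg.
- by move=> j; rewrite invr_ge0.
Qed.

(** The term [k = 1] is at most 1. Any other rough [k] exceeds [z], so [rough_count_le] bounds its
    term by [34 / ln z]; the same lemma then bounds the number of such [k]. *)
Lemma sum_rough_count_div z K : (1 < z)%N ->
  \sum_(1 <= k < K.+1 | rough z k) rough_count R z k / k%:R <=
  1 + 34 ^+ 2 * K%:R / ln z%:R ^+ 2.
Proof.
move=> z1; have hz := ln_ge_half R z1.
have lz0 : 0 < ln z%:R :> R by lra.
have rc1 : rough_count R z 1 <= 1.
  by rewrite /rough_count big_mkcond big_nat1; case: (rough z 1).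
have term k : rough z k -> (1 < k)%N ->
    rough_count R z k / k%:R <= 34 / ln z%:R.
  move=> rk k1; have zk := rough_gt rk k1.
  rewrite ler_pdivrMr ?ltr0n ?(rough_gt0 rk) // mulrAC.
  by apply: rough_count_le; rewrite z1 ltnW.
apply: (@le_trans _ _ (1 + \sum_(1 <= k < K.+1 | rough z k && (1 < k)%N)
    34 / ln z%:R)).
  rewrite (bigID (fun k => 1 < k)%N) /= addrC lerD //.
    case: K => [|K]; first by rewrite big_geq.
    rewrite big_mkcond big_ltn // big1_seq ?addr0 /=; last first.
      move=> k; rewrite mem_index_iota /= => /andP[k1 _].
      by rewrite k1 andbF.
    by rewrite addr0 divr1.
  by apply: ler_sum => k /andP[rk k1]; exact: term.
rewrite lerD2l; have [zK|Kz] := leqP z K; last first.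
  rewrite big_nat_cond big_pred0 ?mulr_ge0 ?invr_ge0 ?sqr_ge0 //.
  move=> k; rewrite ltnS; apply/negP => /andP[/andP[_ kK] /andP[rk k1]].
  by have := rough_gt rk k1; lia.
apply: (@le_trans _ _ (34 / ln z%:R * rough_count R z K)).
  rewrite /rough_count mulr_sumr big_mkcondr; apply: ler_sum => k _.
  by rewrite mulr1; case: ifP => // _; rewrite divr_ge0 // ltW.
apply: (@le_trans _ _ (34 / ln z%:R * (34 * K%:R / ln z%:R))).
  rewrite ler_wpM2l ?divr_ge0 ?(ltW lz0) //.
  by apply: rough_count_le; rewrite z1.
rewrite le_eqVlt; apply/orP; left; apply/eqP; field.
by rewrite gt_eqF.
Qed.

(** The hypothesis on [ln N] bounds the rough sum by [16 * ln z], which makes both contributions of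
    order [N / ln z]. The constant comes from [2 * (34 + 34 ^ 2 * 16) <= 200 ^ 2]. *)
Lemma gcd_sum_le z N : (1 < z <= N)%N -> ln N%:R <= 4 * ln z%:R ^+ 2 :> R ->
  gcd_sum z N <= 200 ^+ 2 * N%:R / ln z%:R.
Proof.
move=> zN hN; have /andP[z1 zN'] := zN; have hz := ln_ge_half R z1.
have lz0 : 0 < ln z%:R :> R by lra.
apply: le_trans (gcd_sum_half z N) _.
apply: (@le_trans _ _ (2 * (rough_count R z N +
    34 ^+ 2 * N%:R / ln z%:R ^+ 2 * rough_sum R z N))).
  rewrite ler_pM2l //; apply: le_trans (gcd_sum_half_le z N) _.
  rewrite /rough_count /rough_sum mulr_sumr -big_split; apply: ler_sum => g rg.
  apply: le_trans (sum_rough_count_div _ z1) _; rewrite lerD2l.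
  have g0 : 0 < g%:R :> R by rewrite ltr0n (rough_gt0 rg).
  rewrite [leRHS]mulrAC ler_wpM2r ?invr_ge0 ?sqr_ge0 //.
  rewrite -[leRHS]mulrA ler_wpM2l ?sqr_ge0 //.
  by rewrite ler_pdivlMr // -natrM ler_nat leq_divM.
have h1 := rough_count_le R zN; have h2 := rough_sum_le R zN.
have h3 : rough_sum R z N <= 16 * ln z%:R.
  by apply: le_trans h2 _; rewrite ler_pdivrMr //; nra.
have h4 : 34 ^+ 2 * N%:R / ln z%:R ^+ 2 * rough_sum R z N <=
    34 ^+ 2 * N%:R / ln z%:R ^+ 2 * (16 * ln z%:R).
  by rewrite ler_wpM2l // divr_ge0 ?sqr_ge0 // mulr_ge0 // sqr_ge0.
have h5 : 34 ^+ 2 * N%:R / ln z%:R ^+ 2 * (16 * ln z%:R) =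
    34 ^+ 2 * 16 * (N%:R / ln z%:R) :> R.
  by field; rewrite gt_eqF.
have h6 : 0 <= N%:R / ln z%:R :> R by rewrite divr_ge0 // ltW.
rewrite -mulrA in h1; rewrite -[leRHS]mulrA; lra.
Qed.
End GcdSum.

(** * Even characters *)

Local Open Scope classical_set_scope.
Local Open Scope ring_scope.
Local Open Scope complex_scope.

(** The polynomial [X^n - 1] splits with distinct roots, and [n] distinct [n]-th roots of unity
    include a primitive one. *)
Lemma prim_root_exists (C : numClosedFieldType) n : (0 < n)%N ->
  exists w : C, n.-primitive_root w.
Proof.
move=> n0; have [r Dp] := closed_field_poly_normal ('X^n - 1 : {poly C}).
rewrite (monicP (monicXnsubC 1 n0)) scale1r in Dp.
have rn1 : all n.-unity_root r.
  by apply/allP => w; rewrite -root_prod_XsubC -Dp.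
have sz_r : (n < (size r).+1)%N.
  by rewrite -(size_prod_XsubC r id) -Dp size_XnsubC.
have [|w] := hasP (has_prim_root n0 rn1 _ sz_r); last by exists w.
by rewrite -separable_prod_XsubC -Dp separable_Xn_sub_1 // pnatr_eq0 -lt0n.
Qed.

Lemma Fp_expr p (a : 'F_p) : prime p -> a ^+ p = a.
Proof. by move=> pp; rewrite -[RHS]expf_card card_Fp. Qed.

Lemma Fp_prim_root p : prime p -> exists g : 'F_p, p.-1.-primitive_root g.
Proof.
move=> pp; have p1 : (0 < p.-1)%N by have := prime_gt1 pp; lia.
pose rs := enum [pred a : 'F_p | a != 0].
have rs1 : all p.-1.-unity_root rs.
  apply/allP => a; rewrite mem_enum inE => a0; apply/unity_rootP.
  apply: (mulfI a0); rewrite mulr1 -exprS prednK ?prime_gt0 //.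
  exact: Fp_expr.
have sz : (p.-1 <= size rs)%N.
  by rewrite -cardE (cardC1 (0 : 'F_p)) card_Fp.
have [|g] := hasP (has_prim_root p1 rs1 _ sz); first exact: enum_uniq.
by exists g.
Qed.

(** With [g] a generator of the nonzero residues and [w] a primitive root of unity of order
    [h = (p - 1) / 2], the characters send [g ^ i] to [w ^ (i * k)] for [k < h]. Since [w ^ i]
    determines [g ^ i] up to sign, the geometric sum over [k] detects [a = b] or [a = - b]. *)
Lemma even_characters (R : realType) (p : nat) : prime p -> (2 < p)%N ->
  exists chi : 'I_(p.-1)./2 -> {ffun 'F_p -> R[i]},
  [/\ forall k, dirichlet_character (chi k) /\ even_character (chi k),
      injective chi &
      forall a b : 'F_p, a != 0 -> b != 0 ->
        \sum_k chi k a * (chi k b)^*%R =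
        if (a == b) || (a == - b) then (p.-1)./2%:R else 0].
Proof.
move=> pp p2; set h := (p.-1)./2.
have oddp : odd p by case: (even_prime pp) p2 => [->|].
have ph : (p.-1 = h * 2)%N by rewrite /h; lia.
have h0 : (0 < h)%N by rewrite /h; lia.
have [g gP] := Fp_prim_root pp.
have [w wP] := prim_root_exists R[i] h0.
(* A discrete logarithm to base [g], unconstrained at 0. *)
have /choice[dl dlP] : forall a : 'F_p, exists i, a != 0 -> a = g ^+ i.
  move=> a; have [->|a0] := eqVneq a 0; first by exists 0%N.
  have a1 : a ^+ p.-1 = 1.
    apply: (mulfI a0); rewrite mulr1 -exprS prednK ?prime_gt0 //.
    exact: Fp_expr.
  by have [i ->] := prim_rootP gP a1; exists i.
have w0 : w != 0.
  apply: contra_eq_neq (prim_expr_order wP) => ->.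
  by rewrite expr0n gtn_eqF // eq_sym oner_eq0.
(* Well-definedness: exponents of [g] count modulo [2 * h], those of [w] modulo [h]. *)
have wE i j : g ^+ i = g ^+ j -> w ^+ i = w ^+ j.
  move=> /eqP; rewrite (eq_prim_root_expr gP) ph => e; apply/eqP.
  rewrite (eq_prim_root_expr wP).
  by rewrite -(@modn_dvdm (h * 2) i) ?dvdn_mulr // (eqP e) modn_dvdm ?dvdn_mulr.
(* Doubling a congruence modulo [h] gives one modulo [p - 1]. *)
have gE i j : w ^+ i = w ^+ j -> (g ^+ i) ^+ 2 = (g ^+ j) ^+ 2.
  move=> /eqP; rewrite (eq_prim_root_expr wP) => /eqP e; apply/eqP.
  rewrite -!exprM (eq_prim_root_expr gP) ph.
  by rewrite -!muln_modl e.
pose chi (k : 'I_h) := [ffun a : 'F_p =>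
  if a == 0 then 0 else (w ^+ dl a) ^+ k].
have chiE k a : a != 0 -> chi k a = (w ^+ dl a) ^+ k.
  by move=> /negbTE a0; rewrite ffunE a0.
have oneF : (1 : 'F_p) != 0 by exact: oner_neq0.
exists chi; split.
- move=> k; split; first split.
  + by rewrite chiE // (wE _ 0%N) ?expr0 ?expr1n // -dlP.
  + move=> a b; have [->|a0] := eqVneq a 0;
    first by rewrite !ffunE mul0r eqxx mul0r.
    have [->|b0] := eqVneq b 0; first by rewrite !ffunE mulr0 eqxx mulr0.
    have ab0 : a * b != 0 by rewrite mulf_neq0.
    by rewrite !chiE // -exprMn -exprD (wE (dl (a * b)) (dl a + dl b)%N) //
      exprD -!dlP.
  + move=> a; rewrite unitfE negbK ffunE; case: eqP => [//|_].
    by split=> // /eqP; rewrite !expf_eq0 (negbTE w0) !andbF.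
  + rewrite /even_character chiE ?oppr_eq0 //.
    have e1 : (g ^+ dl (- 1)) ^+ 2 =
      1 by rewrite -dlP ?oppr_eq0 // sqrrN expr1n.
    suff -> : w ^+ dl (- 1) = 1 by rewrite expr1n.
    apply/eqP; rewrite -(prim_order_dvd wP).
    move/eqP: e1; rewrite -exprM -(prim_order_dvd gP) ph.
    by rewrite dvdn_pmul2r.
- have g0 : g != 0.
    apply: contra_eq_neq (prim_expr_order gP) => ->.
    by rewrite expr0n (gtn_eqF (prim_order_gt0 gP)) eq_sym oner_eq0.
  have wg : w ^+ dl g = w by rewrite (wE _ 1%N) // -dlP.
  move=> k l /ffunP/(_ g); rewrite !chiE // wg => /eqP;
    rewrite (eq_prim_root_expr wP) !modn_small //.
  by move=> /eqP kl; apply: val_inj.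
- move=> a b a0 b0; pose t := w ^+ dl a * (w ^+ dl b)^*%R.
  have -> : \sum_k chi k a * (chi k b)^*%R = \sum_(k < h) t ^+ k.
    by apply: eq_bigr => k _; rewrite !chiE // rmorphXn exprMn.
  have wc : w * w^*%R = 1.
    rewrite -normCK; suff -> : `|w| = 1 by rewrite expr1n.
    apply/eqP; rewrite -(@pexpr_eq1 _ _ h) //.
    by rewrite -normrX (prim_expr_order wP) normr1.
  have th : t ^+ h = 1.
    by rewrite exprMn -rmorphXn -!exprM !(mulnC _ h) !exprM (prim_expr_order wP)
      !expr1n rmorph1 mulr1.
  have tE : t * w ^+ dl b = w ^+ dl a.
    by rewrite -mulrA rmorphXn -exprMn mulrC [w^*%R * w]mulrC wc expr1n mul1r.
  have -> : (a == b) || (a == - b) = (t == 1).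
    rewrite -eqf_sqr; apply/eqP/eqP.
      rewrite {1}(dlP a a0) {1}(dlP b b0) => e.
      have e2 : (w ^+ dl a) = w ^+ dl b.
        apply/eqP; rewrite (eq_prim_root_expr wP).
        move/eqP: e; rewrite -!exprM (eq_prim_root_expr gP) ph -!muln_modl.
        by rewrite eqn_mul2r.
      apply: (mulIf (_ : w ^+ dl b != 0)); first by rewrite expf_neq0.
      by rewrite tE mul1r.
    move=> t1; rewrite {1}(dlP a a0) {1}(dlP b b0); apply: gE.
    by rewrite -tE t1 mul1r.
  case: eqP => [->|/eqP t1].
    by under eq_bigr => k _ do rewrite expr1n; rewrite sumr_const card_ord.
  have := subrX1 t h; rewrite th subrr => /esym/eqP.
  by rewrite mulf_eq0 subr_eq0 (negbTE t1) => /eqP.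
Qed.

(** * Collisions modulo p *)

(** A geometric series of ratio [q = expR (- u)]; [1 + u <= expR u] bounds [1 / (1 - q)] by
    [(1 + u) / u]. *)
Lemma sum_expRN_le (R : realType) (u : R) J : 0 < u ->
  \sum_(0 <= j < J) expR (- (u * j%:R)) <= 1 + u^-1.
Proof.
move=> u0; set q := expR (- u).
have q1 : q * (1 + u) <= 1.
  rewrite /q expRN mulrC ler_pdivrMr ?expR_gt0 // mul1r; exact: expR_ge1Dx.
have -> : \sum_(0 <= j < J) expR (- (u * j%:R)) = \sum_(i < J) q ^+ i.
  rewrite big_mkord; apply: eq_bigr => j _.
  by rewrite /q -expRM_natl mulrN [u * _]mulrC.
have e := subrX1 q J; set S := \sum_(_ < _) _ in e *.
have q0 : 0 <= q ^+ J by rewrite exprn_ge0 // expR_ge0.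
have S0 : 0 <= S by rewrite sumr_ge0 // => i _; rewrite exprn_ge0 // expR_ge0.
have -> : 1 + u^-1 = (1 + u) / u by rewrite mulrDl divff ?gt_eqF // mul1r addrC.
rewrite ler_pdivlMr //.
have h1 : (1 - q) * S <= 1 by lra.
have h2 : (1 + u) * ((1 - q) * S) <= (1 + u) * 1 by rewrite ler_wpM2l //; lra.
have h3 : q * (1 + u) * S <= 1 * S by rewrite ler_wpM2r.
lra.
Qed.

Lemma eq_mod_gcd m d a b : (0 < d)%N -> (a * m = b * m %[mod d])%N ->
  (a = b %[mod d %/ gcdn m d])%N.
Proof.
move=> d0; wlog ab : a b / (b <= a)%N.
  move=> wl; have [ba|/ltnW ab] := leqP b a; first exact: wl.
  by move=> /esym/(wl _ _ ab).
have g0 : (0 < gcdn m d)%N by rewrite gcdn_gt0 d0 orbT.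
move=> /eqP; rewrite eqn_mod_dvd ?leq_mul // -mulnBl => h; apply/eqP.
rewrite eqn_mod_dvd // -(@Gauss_dvdl _ _ (m %/ gcdn m d)).
  rewrite -(@dvdn_pmul2r (gcdn m d)) // -mulnA !divnK ?dvdn_gcdl ?dvdn_gcdr //.
rewrite /coprime -(eqn_pmul2r g0) mul1n muln_gcdl.
by rewrite !divnK ?dvdn_gcdl ?dvdn_gcdr // gcdnC.
Qed.

(** The alternatives are the two signs that even characters cannot distinguish. *)
Definition collision (p m1 m2 n1 n2 : nat) :=
  ((n1 * m1 == n2 * m2 %[mod p]) || (p %| n1 * m1 + n2 * m2))%N.

Lemma collisionC p m1 m2 n1 n2 :
  collision p m1 m2 n1 n2 = collision p m2 m1 n2 n1.
Proof. by rewrite /collision eq_sym addnC. Qed.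

(* A collision is determined by the sign and the size of
   [l = (n1 * m1 -+ n2 * m2) / p] together with [n1]; for a fixed [l] the
   admissible [n1] are congruent modulo [m2 / gcd m1 m2]. *)
Lemma sum_collision_le (R : realType) (p N m1 m2 T : nat) (s : R) :
  0 < s -> (0 < p)%N -> (N ^ 2 <= p)%N -> (0 < m1 <= N)%N -> (0 < m2 <= N)%N ->
  \sum_(1 <= n1 < T) \sum_(1 <= n2 < T | collision p m1 m2 n1 n2)
    expR (- (s ^+ 2 / p%:R * n1%:R ^+ 2)) *
    expR (- (s ^+ 2 / p%:R * n2%:R ^+ 2)) <=
  3 * expR (1 / 2) * (1 + 2 / s) ^+ 2 *
    (Num.sqrt p%:R * ((gcdn m1 m2)%:R / m2%:R)).
Proof.
move=> s0 p0 Np /andP[m10 m1N] /andP[m20 m2N].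
set g := gcdn m1 m2; set D := (m2 %/ g)%N.
have g0 : (0 < g)%N by rewrite gcdn_gt0 m10.
have Dg : (D * g = m2)%N by rewrite divnK // dvdn_gcdr.
have D0 : (0 < D)%N by move: m20; rewrite -Dg muln_gt0 => /andP[].
(* The tag 0, 1 or 2 records the sign and, for equal residues, which product is larger, so that the
   subtraction never truncates. The last entry is the block of length [D] that contains [n1]. *)
pose f (x : nat * nat) : nat * (nat * nat) :=
  (if x.1 * m1 == x.2 * m2 %[mod p] then
     if x.2 * m2 <= x.1 * m1 then (0, ((x.1 * m1 - x.2 * m2) %/ p, x.1 %/ D))
     else (1, ((x.2 * m2 - x.1 * m1) %/ p, x.1 %/ D))
   else (2, ((x.1 * m1 + x.2 * m2) %/ p, x.1 %/ D)))%N.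
have fP x : collision p m1 m2 x.1 x.2 ->
    [/\ (f x).2.2 = (x.1 %/ D)%N, ((f x).2.1 * p <= x.1 * m1 + x.2 * m2)%N &
     [\/ ((f x).1 = 0 /\ x.1 * m1 = x.2 * m2 + (f x).2.1 * p)%N,
        ((f x).1 = 1 /\ x.2 * m2 = x.1 * m1 + (f x).2.1 * p)%N |
        ((f x).1 = 2 /\ x.1 * m1 + x.2 * m2 = (f x).2.1 * p)%N]].
  rewrite /f /collision; case: ifP => [e _|_ /= e].
    case: leqP => /= [le|/ltnW le]; split=> //.
    + by rewrite (leq_trans (leq_divM _ _)) //; lia.
    + by apply: Or31; split => //; rewrite divnK -?eqn_mod_dvd // subnKC.
    + by rewrite (leq_trans (leq_divM _ _)) //; lia.
    + by apply: Or32; split => //;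
      rewrite divnK -?eqn_mod_dvd ?subnKC // eq_sym.
  by split; rewrite ?divnK //; apply: Or33.
set P : R := Num.sqrt p%:R.
have pR : 0 < p%:R :> R by rewrite ltr0n.
have P0 : 0 < P by rewrite sqrtr_gt0.
have P2 : p%:R = P * P by rewrite -expr2 sqr_sqrtr // ltW.
have NP : N%:R <= P.
  by rewrite -ler_sqr ?nnegrE ?(ltW P0) // [leRHS]expr2 -P2 -natrX ler_nat.
(* After linearization of the exponent, half of the decay pays for [l] and half for [j]. *)
pose G (t l j : nat) : R :=
  expR (1 / 2) * (expR (- (s / 2 * l%:R)) * expR (- (s / P / 2 * D%:R * j%:R))).
have [K KE] : exists K, K = 3%N by exists 3%N.
have [L LE] : exists L, L = (T * N + T * N).+1 by eexists.
apply: (@le_trans _ _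
  (\sum_(0 <= t < K) \sum_(0 <= l < L) \sum_(0 <= j < T) G t l j)).
  under [leRHS]eq_bigr => t _ do rewrite sum_pair_seq.
  rewrite !sum_pair_seq.
  have uq (I J : eqType) (r : seq I) (r' : seq J) : uniq r -> uniq r' ->
      uniq [seq (i, j) | i <- r, j <- r'].
    by move=> ur us; apply: allpairs_uniq => // -[? ?] [? ?].
  apply: (@ler_sum_inj _ _ _ _ _ _ _ f).
  - by rewrite uq ?iota_uniq.
  - by rewrite !uq ?iota_uniq.
  - move=> _ /allpairsP[[n1 n2] /= [+ + ->]]; rewrite !mem_index_iota.
    move=> /andP[n10 n1T] /andP[n20 n2T] /= c; have := fP (n1, n2) c.
    case: (f _) => t [l j] /= [-> hl ht]; split => //.
    + have lL : (l < L)%N.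
        rewrite LE ltnS; apply: leq_trans (leq_pmulr l p0) _;
          apply: leq_trans hl _.
        by rewrite leq_add // leq_mul // ltnW.
      apply: allpairs_f; first by rewrite mem_index_iota KE;
        case: ht => -[-> _].
      apply: allpairs_f; rewrite mem_index_iota //=.
      exact: leq_ltn_trans (leq_div _ _) n1T.
    + rewrite /G /= -!expRD ler_expR.
      (* Expanding the square of [s / P * n - 1 / 2] trades Gaussian for linear decay, at a cost of
         [1 / 4] for each of [n1] and [n2]; hence the factor [expR (1 / 2)]. *)
      have sq (n : nat) : s / P * n%:R - 1 / 4 <=
        s ^+ 2 / p%:R * n%:R ^+ 2 :> R.
        have -> : s ^+ 2 / p%:R * n%:R ^+ 2 = (s / P * n%:R) ^+ 2.
          by rewrite P2; field; rewrite gt_eqF.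
        by have := sqr_ge0 (s / P * n%:R - 1 / 2); rewrite !expr2; lra.
      have h1 := sq n1; have h2 := sq n2.
      have sP : 0 < s / P by rewrite divr_gt0.
      have hj : s / P * (D%:R * (n1 %/ D)%:R) <= s / P * n1%:R.
        by rewrite ler_pM2l // -natrM ler_nat mulnC leq_divM.
      have hl' : s * l%:R <= s / P * (n1%:R + n2%:R).
        rewrite -[leRHS]mulrA ler_pM2l // ler_pdivlMl //.
        rewrite -(ler_pM2l P0) mulrA -P2 -natrM.
        apply: (@le_trans _ _ (N%:R * (n1%:R + n2%:R))); last first.
          by rewrite ler_wpM2r // addr_ge0.
        rewrite -natrD -natrM ler_nat mulnC; apply: leq_trans hl _.
        by rewrite mulnDr leq_add // mulnC leq_mul.
      have hb : 0 <= s / P * n2%:R by rewrite mulr_ge0 // ltW.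
      lra.
  - move=> [n1 n2] [n1' n2'] _ /= c _ c' e.
    have := fP (n1, n2) c; have := fP (n1', n2') c'; rewrite e /=.
    case: (f _) => t [l j] /= [-> _ h'] [hj _ h].
    (* With equal tags and equal [l] the multiples of [p] cancel, which leaves a congruence modulo
       [m2]. It fixes [n1] modulo [D]; the block then fixes [n1], and [n1] fixes [n2]. *)
    have hmod : (n1 * m1 = n1' * m1 %[mod m2])%N /\ (n1 = n1' -> n2 * m2 =
      n2' * m2)%N.
      have e1 : (n1 * m1 + n2' * m2 = n1' * m1 + n2 * m2)%N \/
                (n1 * m1 + n2 * m2 = n1' * m1 + n2' * m2)%N.
        by case: h => -[? ?]; case: h' => -[? ?]; lia.
      split=> [|e2]; last by move: e1; rewrite e2; lia.
      have md a b : (a + b * m2 = a %[mod m2])%N by rewrite addnC modnMDl.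
      case: e1 => e1; first by rewrite -(md _ n2') e1 md.
      by rewrite -(md _ n2) e1 md.
    have [h1 h2] := hmod.
    have n1E : n1 = n1'.
      rewrite (divn_eq n1 D) (divn_eq n1' D) hj; congr (_ + _)%N.
      exact: eq_mod_gcd h1.
    by have /eqP := h2 n1E; rewrite n1E eqn_pmul2r // => /eqP ->.
  - by move=> x; rewrite !mulr_ge0 // expR_ge0.
have -> : \sum_(0 <= t < K) \sum_(0 <= l < L) \sum_(0 <= j < T) G t l j =
    3 * expR (1 / 2) * ((\sum_(0 <= l < L) expR (- (s / 2 * l%:R))) *
      \sum_(0 <= j < T) expR (- (s / P / 2 * D%:R * j%:R))).
  rewrite /G (sumr_const_nat K 0) subn0 KE -[LHS]mulr_natl -[RHS]mulrA.
  congr (_ * _).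
  rewrite big_distrlr mulr_sumr; apply: eq_bigr => l _.
  by rewrite mulr_sumr.
rewrite -[leRHS]mulrA ler_pM2l; last by rewrite mulr_gt0 // expR_gt0.
have DR : 0 < D%:R :> R by rewrite ltr0n.
have gR : 1 <= g%:R :> R by rewrite ler1n.
have m2R : m2%:R = D%:R * g%:R :> R by rewrite -natrM Dg.
rewrite expr2 -[leRHS]mulrA; apply: ler_pM.
- by rewrite sumr_ge0 // => l _; exact: expR_ge0.
- by rewrite sumr_ge0 // => l _; exact: expR_ge0.
- apply: le_trans (sum_expRN_le _ _) _; first by rewrite divr_gt0.
  by rewrite invf_div.
- apply: le_trans (sum_expRN_le _ _) _.
    by rewrite mulr_gt0 // divr_gt0 // divr_gt0.
  have -> : P * (g%:R / m2%:R) = P / D%:R.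
    by rewrite m2R; field; rewrite !gt_eqF // (lt_le_trans ltr01).
  (* This absorbs the 1: [1 + 2 / s * (P / D) <= (1 + 2 / s) * (P / D)]. *)
  have DP : 1 <= P / D%:R.
    rewrite ler_pdivlMr // mul1r; apply: le_trans NP; rewrite ler_nat.
    exact: leq_trans (leq_div _ _) m2N.
  have -> : (s / P / 2 * D%:R)^-1 = 2 / s * (P / D%:R).
    by field; rewrite !gt_eqF.
  by rewrite [leRHS]mulrDl mul1r lerD2r.
Qed.

(** * Theta series and moments *)

Import Normc.

Lemma norm_normc (R : realType) (z : R[i]) : `|z| = (normc z)%:C.
Proof. by []. Qed.

Lemma normc_ge0 (R : realType) (z : R[i]) : 0 <= normc z.
Proof. by rewrite -lecR -norm_normc normr_ge0. Qed.

Lemma normc_real (R : realType) (k : R) : normc k%:C = `|k|.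
Proof. by rewrite /normc /= expr0n addr0 sqrtr_sqr. Qed.

Lemma Re_le_normc (R : realType) (z : R[i]) : `|complex.Re z| <= normc z.
Proof.
case: z => u v; rewrite /normc /= -sqrtr_sqr ler_wsqrtr // lerDl.
exact: sqr_ge0.
Qed.

Lemma Im_le_normc (R : realType) (z : R[i]) : `|complex.Im z| <= normc z.
Proof.
case: z => u v; rewrite /normc /= -sqrtr_sqr ler_wsqrtr // lerDr.
exact: sqr_ge0.
Qed.

(** By Fermat's little theorem a nonzero value has absolute value a root of [X^(p - 1) = 1], hence
    1. *)
Lemma norm_dirichlet_character_le1 (R : realType) (p : nat)
    (chi : {ffun 'F_p -> R[i]}) (a : 'F_p) :
  prime p -> dirichlet_character chi -> normc (chi a) <= 1.
Proof.
move=> pp [chi1 chiM chi0]; rewrite -lecR -norm_normc.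
have [->|a0] := eqVneq (chi a) 0; first by rewrite normr0 lecR.
have chiX n : chi (a ^+ n) = chi a ^+ n.
  by elim: n => [|n IH]; rewrite ?expr0 // !exprS chiM IH.
have : `|chi a| ^+ p.-1 = 1.
  rewrite -normrX; apply: (mulfI (_ : `|chi a| != 0));
    first by rewrite normr_eq0.
  by rewrite mulr1 -normrM -exprS prednK ?prime_gt0 // -chiX Fp_expr.
move/eqP; rewrite pexpr_eq1 //; last by have := prime_gt1 pp; lia.
by move/eqP ->.
Qed.

Lemma cvg_complex (R : realType) (f : nat -> R[i]) (a b : R) :
  (fun n => complex.Re (f n)) @ \oo --> a -> (fun n =>
    complex.Im (f n)) @ \oo --> b ->
  (f : nat -> R[i]^o) @ \oo --> (a +i* b : R[i]^o).
Proof.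
move=> /cvgrPdist_lt fa /cvgrPdist_lt fb; apply/cvgrPdist_lt => e e0.
have eE : e = (complex.Re e)%:C by apply/esym/RRe_real/gtr0_real.
have re0 : 0 < complex.Re e by rewrite -ltcR -eE.
have re2 : 0 < complex.Re e / 2 by rewrite divr_gt0.
near=> n.
have ha : `|a - complex.Re (f n)| < complex.Re e / 2 by near: n; exact: fa.
have hb : `|b - complex.Im (f n)| < complex.Re e / 2 by near: n; exact: fb.
have -> : (a +i* b) - f n =
  (a - complex.Re (f n))%:C + 'i%C * (b - complex.Im (f n))%:C.
  by rewrite [LHS]complexE; case: (f n).
apply: le_lt_trans (ler_normD _ _) _; rewrite normrM complexiE normCi mul1r.
by rewrite eE !norm_normc !normc_real -rmorphD ltcR; lra.
Unshelve. all: by end_near. Qed.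

Section ThetaSeries.
Variables (R : realType) (p : nat) (x : R) (chi : {ffun 'F_p -> R[i]}).
Hypotheses (pp : prime p) (x0 : 0 < x) (hchi : dirichlet_character chi).

Let a (n : nat) : R[i] :=
  chi n%:R * (expR (- (pi * n%:R ^+ 2 * x / p%:R)))%:C.

Lemma norm_theta_term_le n : normc (a n) <= expR (- (pi * x / p%:R)) ^+ n.
Proof.
rewrite normcM.
have pR : 0 < p%:R :> R by rewrite ltr0n prime_gt0.
have pix : 0 <= pi * x / p%:R.
  by rewrite divr_ge0 ?ltW // mulr_gt0 // pi_gt0.
rewrite -expRM_natl -[leRHS]mul1r ler_pM ?normc_ge0 //.
  exact: norm_dirichlet_character_le1.
rewrite normc_real ger0_norm ?expR_ge0 // ler_expR mulrN lerN2.
rewrite [leRHS](_ : _ = n%:R ^+ 2 * (pi * x / p%:R)); last by ring.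
by rewrite ler_wpM2r // -natrX ler_nat expnS expn1; case: n => // n;
  rewrite leq_pmulr.
Qed.

(** Real and imaginary parts converge absolutely, by comparison with a geometric series. *)
Lemma theta_series_cvg :
  cvgn (fun N => \sum_(1 <= n < N) a n : R[i]^o).
Proof.
(* The term at 0 vanishes because [chi 0 = 0], so the partial sums are those of a [series]. *)
have -> : (fun N => \sum_(1 <= n < N) a n : R[i]^o) =
          (fun N => \sum_(0 <= n < N) a n).
  apply/funext => -[|N]; first by rewrite !big_geq.
  rewrite [RHS]big_ltn // {2}/a.
  have [_ _ /(_ 0)[_ ->]] := hchi; first by rewrite mul0r add0r.
  by rewrite unitfE eqxx.
have pR : 0 < p%:R :> R by rewrite ltr0n prime_gt0.
set q := expR (- (pi * x / p%:R)).
have q1 : `|q| < 1.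
  rewrite ger0_norm ?expR_ge0 // expR_lt1 oppr_lt0.
  by rewrite divr_gt0 // mulr_gt0 // pi_gt0.
have cv (v : nat -> R) : (forall n, `|v n| <= normc (a n)) -> cvgn (series v).
  move=> hv; apply: normed_cvg.
  apply: (series_le_cvg _ _ _ (@is_cvg_geometric_series R 1 q q1)) => n.
  - exact: normr_ge0.
  - by rewrite /geometric /= mul1r exprn_ge0 // expR_ge0.
  - rewrite /geometric /= mul1r; apply: le_trans (hv n) _.
    exact: norm_theta_term_le.
have cRe : cvgn (series (fun n => complex.Re (a n))).
  by apply: cv => n; exact: Re_le_normc.
have cIm : cvgn (series (fun n => complex.Im (a n))).
  by apply: cv => n; exact: Im_le_normc.
apply: (cvgP (lim (series (fun n => complex.Re (a n)) @ \oo) +i*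
              lim (series (fun n => complex.Im (a n)) @ \oo) : R[i]^o)).
apply: cvg_complex.
- rewrite (_ : (fun n => _) = series (fun n => complex.Re (a n))) //.
  by apply/funext => n; rewrite /series /= raddf_sum.
- rewrite (_ : (fun n => _) = series (fun n => complex.Im (a n))) //.
  by apply/funext => n; rewrite /series /= raddf_sum.
Qed.

(** By convergence [theta] is a genuine limit, so its vanishing passes to long partial sums. The
    moments can then be taken over finite sums. *)
Lemma theta_eq0_small (e : R) : theta x chi = 0 -> 0 < e ->
  exists T0, forall T, (T0 <= T)%N -> normc (\sum_(1 <= n < T) a n) <= e.
Proof.
move=> th0 e0; have := theta_series_cvg.
rewrite /theta in th0.
move=> /cvg_ex[l hl].
have l0 : l = 0.
  by rewrite -th0; apply/esym; exact: (cvg_lim (@norm_hausdorff _ _) hl).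
move: hl; rewrite l0 => /cvgrPdist_lt/(_ e%:C);
  rewrite ltcR => /(_ e0)[T0 _ hT].
exists T0 => T /hT /=; rewrite sub0r normrN norm_normc ltcR; exact: ltW.
Qed.
End ThetaSeries.

Lemma Fp_natr_eq p a b : prime p -> ((a%:R : 'F_p) == b%:R) =
  (a == b %[mod p])%N.
Proof. by move=> pp; rewrite -val_eqE /= !val_Fp_nat. Qed.

Lemma Fp_natr_eq0 p a : prime p -> ((a%:R : 'F_p) == 0) = (p %| a)%N.
Proof. by move=> pp; rewrite (Fp_natr_eq a 0 pp) mod0n. Qed.

Lemma Fp_natr_eqN p a b : prime p -> ((a%:R : 'F_p) == - b%:R) = (p %| a + b)%N.
Proof. by move=> pp; rewrite -addr_eq0 -natrD Fp_natr_eq0. Qed.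

(** * First and second moments over the even characters *)

Section Moments.
Variables (R : realType) (p h : nat) (chi : 'I_h -> {ffun 'F_p -> R[i]}).
Hypothesis pp : prime p.
Hypothesis hchi : forall k, dirichlet_character (chi k).
Hypothesis orth : forall a b : 'F_p, a != 0 -> b != 0 ->
  \sum_k chi k a * (chi k b)^*%R = if (a == b) || (a == - b) then h%:R else 0.

Lemma chi0 k : chi k 0 = 0.
Proof.
have [_ _ /(_ 0)[_ ->]] := hchi k; by rewrite // unitfE eqxx.
Qed.

(** An inequality only, because [a] and [b] may be 0: the left side is then 0 even where [a = b]. *)
Lemma sum_chi_conj_le (a b : 'F_p) (c : R) : 0 <= c ->
  c%:C * (\sum_k chi k a * (chi k b)^*%R) <=
  ((if (a == b) || (a == - b) then c else 0) * h%:R)%:C.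
Proof.
move=> c0.
have z0 (t : bool) : 0 <= ((if t then c else 0) * h%:R)%:C :> R[i].
  by rewrite lecR mulr_ge0 //; case: t.
have [->|a0] := eqVneq a 0.
  by rewrite big1 ?mulr0 // => k _; rewrite chi0 mul0r.
have [->|b0] := eqVneq b 0.
  by rewrite big1 ?mulr0 // => k _; rewrite chi0 rmorph0 mulr0.
rewrite orth //; case: ifP => _; last by rewrite mulr0 mul0r.
by rewrite rmorphM rmorph_nat.
Qed.

(** Expand the square and apply orthogonality to each pair of terms. *)
Lemma sum_sqr_norm_le (I : Type) (r : seq I) (P : pred I) (c : I -> R)
    (a : I -> 'F_p) : (forall i, 0 <= c i) ->
  \sum_k normc (\sum_(i <- r | P i) (c i)%:C * chi k (a i)) ^+ 2 <=
  h%:R * \sum_(i <- r | P i)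
    \sum_(j <- r | P j && ((a i == a j) || (a i == - a j))) c i * c j.
Proof.
move=> c0; rewrite -lecR rmorph_sum /=.
have -> : \sum_k (normc (\sum_(i <- r | P i) (c i)%:C * chi k (a i)) ^+ 2)%:C =
  \sum_(i <- r | P i) \sum_(j <- r | P j)
    (c i * c j)%:C * (\sum_k chi k (a i) * (chi k (a j))^*%R).
  under [RHS]eq_bigr => i _ do
    (under eq_bigr => j _ do rewrite mulr_sumr; rewrite exchange_big /=).
  rewrite [RHS]exchange_big /=; apply: eq_bigr => k _.
  rewrite rmorphXn /= -norm_normc normCK rmorph_sum big_distrlr /=.
  apply: eq_bigr => i _; apply: eq_bigr => j _.
  rewrite [((c j)%:C * _)^*%R]rmorphM /= [((c j)%:C)^*%R]geC0_conj ?lecR //.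
  by rewrite [(c i * c j)%:C]rmorphM mulrACA.
rewrite mulrC mulr_suml rmorph_sum; apply: ler_sum => i _ /=.
rewrite mulr_suml rmorph_sum big_mkcondr; apply: ler_sum => j _ /=.
apply: le_trans (sum_chi_conj_le _ _ (mulr_ge0 (c0 i) (c0 j))) _.
by case: ifP => // _; rewrite mul0r.
Qed.

(** The product of the two sums is one sum over pairs [(m, n)] of [chi (n * m)], and orthogonality
    leaves exactly the pairs in [collision]. *)
Lemma second_moment_le (z N T : nat) (s : R) :
  0 < s -> (N ^ 2 <= p)%N ->
  \sum_k (normc (\sum_(1 <= n < T)
              chi k n%:R * (expR (- (s ^+ 2 / p%:R * n%:R ^+ 2)))%:C) *
          normc (\sum_(1 <= m < N.+1 | rough z m) chi k m%:R)) ^+ 2 <=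
  h%:R * (3 * expR (1 / 2) * (1 + 2 / s) ^+ 2 *
    (Num.sqrt p%:R * gcd_sum R z N)).
Proof.
move=> s0 Np; set C := 3 * _ * _.
set w := fun n : nat => expR (- (s ^+ 2 / p%:R * n%:R ^+ 2)).
have w0 n : 0 <= w n by exact: expR_ge0.
pose r := [seq (m, n) | m <- index_iota 1 N.+1, n <- index_iota 1 T].
pose c (y : nat * nat) := w y.2.
pose a (y : nat * nat) : 'F_p := (y.2 * y.1)%:R.
have e k : normc (\sum_(1 <= n < T) chi k n%:R * (w n)%:C) *
    normc (\sum_(1 <= m < N.+1 | rough z m) chi k m%:R) =
    normc (\sum_(y <- r | rough z y.1 && true) (c y)%:C * chi k (a y)).
  rewrite mulrC -normcM big_distrlr /= sum_pair_seq; congr normc.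
  apply: eq_bigr => -[m n] _ /=; rewrite /a /c /= natrM.
  by have [_ -> _] := hchi k; rewrite mulrCA mulrA mulrC [_ * chi k m%:R]mulrC.
under eq_bigr => k _ do rewrite e.
apply: le_trans (sum_sqr_norm_le _ _ _ (fun y => w0 y.2)) _.
rewrite ler_wpM2l //.
have -> : \sum_(i <- r | rough z i.1 && true)
      \sum_(j <- r | (rough z j.1 && true) && ((a i == a j) || (a i == - a j)))
         w i.2 * w j.2 =
   \sum_(1 <= m1 < N.+1 | rough z m1) \sum_(1 <= m2 < N.+1 | rough z m2)
     \sum_(1 <= n1 < T) \sum_(1 <=
       n2 < T | collision p m1 m2 n1 n2) w n1 * w n2.
  rewrite /r -(sum_pair_seq _ _ _ (fun _ _ => true) (fun m1 n1 =>
    \sum_(j <- r | (rough z j.1 && true) &&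
      ((a (m1, n1) == a j) || (a (m1, n1) == - a j))) w n1 * w j.2)).
  apply: eq_bigr => m1 _; rewrite [RHS]exchange_big; apply: eq_bigr => n1 _.
  rewrite [RHS]sum_pair_seq; apply: eq_bigl => -[m2 n2] /=.
  by rewrite andbT /a /= Fp_natr_eq // Fp_natr_eqN.
have -> : C * (Num.sqrt p%:R * gcd_sum R z N) =
   \sum_(1 <= m1 < N.+1 | rough z m1) \sum_(1 <= m2 < N.+1 | rough z m2)
      C * (Num.sqrt p%:R * ((gcdn m1 m2)%:R / (maxn m1 m2)%:R)).
  rewrite /gcd_sum !mulr_sumr; apply: eq_bigr => m1 _.
  by rewrite !mulr_sumr.
have p0 := prime_gt0 pp.
rewrite big_nat_cond [leRHS]big_nat_cond; apply: ler_sum => m1.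
rewrite ltnS => /andP[m1N _].
rewrite big_nat_cond [leRHS]big_nat_cond; apply: ler_sum => m2.
rewrite ltnS => /andP[m2N _].
(* The collision bound has [m2] in its denominator; exchanging the two pairs if necessary makes this
   the larger of [m1] and [m2]. *)
have [le|/ltnW le] := leqP m1 m2.
  exact: (@sum_collision_le R p N).
rewrite gcdnC; apply: le_trans (sum_collision_le _ s0 p0 Np m2N m1N).
rewrite (exchange_big_dep predT) //=; apply: ler_sum => n2 _.
rewrite le_eqVlt; apply/orP; left; apply/eqP.
by apply: eq_big => n1 *; rewrite 1?collisionC 1?mulrC.
Qed.

(** By the triangle inequality it suffices to bound the sum of the first factor times the conjugate
    of the second. There orthogonality makes every pair [(n, m)] contribute a nonnegative amount,
    and the diagonal gives at least [h * w0] for each rough [m]. *)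
Lemma first_moment_ge (z N T : nat) (w : nat -> R) (w0 : R) :
  (N < p)%N -> (N < T)%N -> (forall n, 0 <= w n) ->
  (forall n, (0 < n <= N)%N -> w0 <= w n) ->
  h%:R * (w0 * rough_count R z N) <=
  \sum_k normc (\sum_(1 <= n < T) chi k n%:R * (w n)%:C) *
         normc (\sum_(1 <= m < N.+1 | rough z m) chi k m%:R).
Proof.
move=> Np NT w_ge0 w_ge.
pose G (n m : nat) : R[i] :=
  (w n)%:C * (\sum_k chi k n%:R * (chi k m%:R)^*%R).
have G0 n m : (0 < m <= N)%N -> 0 <= G n m.
  move=> /andP[m0 mN]; rewrite /G mulr_ge0 //; first by rewrite lecR.
  have [->|n0] := eqVneq (n%:R : 'F_p) 0.
    by rewrite big1 // => k _; rewrite chi0 mul0r.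
  rewrite orth //; first by case: ifP.
  by rewrite Fp_natr_eq0 // gtnNdvd //; lia.
have e : \sum_(1 <= m < N.+1 | rough z m) \sum_(1 <= n < T) G n m =
    \sum_k (\sum_(1 <= n < T) chi k n%:R * (w n)%:C) *
           (\sum_(1 <= m < N.+1 | rough z m) chi k m%:R)^*%R.
  under [RHS]eq_bigr => k _ do
    rewrite mulrC rmorph_sum big_distrlr /=.
  rewrite [RHS]exchange_big; apply: eq_bigr => m _ /=.
  rewrite [RHS]exchange_big; apply: eq_bigr => n _ /=.
  rewrite /G mulr_sumr; apply: eq_bigr => k _.
  by rewrite [LHS]mulrC [RHS]mulrCA mulrA.
have h1 : (h%:R * (w0 * rough_count R z N))%:C <=
    \sum_(1 <= m < N.+1 | rough z m) \sum_(1 <= n < T) G n m.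
  rewrite /rough_count !mulr_sumr rmorph_sum.
  rewrite big_nat_cond [leRHS]big_nat_cond; apply: ler_sum => m.
  rewrite ltnS => /andP[mN _]; have /andP[m0 mN'] := mN.
  have mT : (m < T)%N by lia.
  rewrite (bigD1_seq m) ?iota_uniq ?mem_index_iota ?m0 //= ler_wpDr //.
    by apply: sumr_ge0 => n _; exact: G0.
  have mp : (m%:R : 'F_p) != 0 by rewrite Fp_natr_eq0 // gtnNdvd //; lia.
  rewrite /G orth // eqxx mulr1 mulrC rmorphM rmorph_nat ler_wpM2r //.
  by rewrite lecR w_ge.
rewrite -lecR rmorph_sum /=.
apply: (@le_trans _ _ `|\sum_(1 <= m < N.+1 | rough z m) \sum_(1 <=
  n < T) G n m|).
  rewrite ger0_norm // big_nat_cond; apply: sumr_ge0 => m.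
  by rewrite ltnS => /andP[mN _]; apply: sumr_ge0 => n _; exact: G0.
rewrite e; apply: le_trans (ler_norm_sum _ _ _) _; apply: ler_sum => k _.
by rewrite normrM norm_conjC !norm_normc -rmorphM.
Qed.

Lemma norm_sum_chi_rough_le z N k :
  normc (\sum_(1 <= m < N.+1 | rough z m) chi k m%:R) <= rough_count R z N.
Proof.
rewrite -lecR -norm_normc; apply: le_trans (ler_norm_sum _ _ _) _.
rewrite rmorph_sum; apply: ler_sum => m _; rewrite norm_normc lecR.
exact: norm_dirichlet_character_le1.
Qed.
End Moments.

(** * Counting nonvanishing characters *)

(** Cauchy-Schwarz on [S], read off from the nonnegativity of the sum of [(U * u k - V) ^ 2]. *)
Lemma sqr_sum_le_card (R : realType) (I : finType) (S : pred I) (u : I -> R)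
    (U V : R) : 0 < U -> 0 < V ->
  U <= \sum_(k | S k) u k -> \sum_(k | S k) u k ^+ 2 <= V ->
  U ^+ 2 <= #|S|%:R * V.
Proof.
move=> U0 V0 hU hV.
have : 0 <= \sum_(k | S k) (U * u k - V) ^+ 2 by apply: sumr_ge0 => k _;
  exact: sqr_ge0.
have -> : \sum_(k | S k) (U * u k - V) ^+ 2 =
    U ^+ 2 * \sum_(k | S k) u k ^+ 2 - 2 * U * V * \sum_(k | S k) u k +
    #|S|%:R * V * V.
  have -> : #|S|%:R * V * V = \sum_(k | S k) V * V.
    by rewrite -mulrA mulr_natl -sumr_const.
  by rewrite !mulr_sumr -sumrB -big_split; apply: eq_bigr => k _ /=; ring.
have h1 : U ^+ 2 * \sum_(k | S k) u k ^+ 2 <= U ^+ 2 * V.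
  by rewrite ler_wpM2l // sqr_ge0.
have h2 : 2 * U * V * U <= 2 * U * V * \sum_(k | S k) u k.
  by rewrite ler_wpM2l // !mulr_ge0 // ltW.
move=> h; rewrite -(ler_pM2r V0); nra.
Qed.

(** Take the integer part of [expR Y] with [Y = sqrt (ln N)]. Here [Y >= 10] gives
    [10 * ln z <= Y ^ 2 = ln N], and [Y <= ln z + 1 <= 2 * ln z]. *)
Lemma sieve_level_exists (R : realType) (N : nat) : expR 100 <= N%:R :> R ->
  exists z : nat, [/\ (6 < z)%N, (z ^ 10 <= N)%N,
    ln N%:R <= 4 * ln z%:R ^+ 2 :> R & ln z%:R <= Num.sqrt (ln N%:R) :> R].
Proof.
move=> hN; have NR : 0 < N%:R :> R by apply: lt_le_trans hN; exact: expR_gt0.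
have lN : 100 <= ln N%:R :> R by rewrite -[100]expRK ler_ln ?posrE ?expR_gt0.
set Y : R := Num.sqrt (ln N%:R).
have Y0 : 0 <= Y by exact: sqrtr_ge0.
have Y2 : Y * Y = ln N%:R by rewrite -expr2 sqr_sqrtr //; lra.
have Y10 : 10 <= Y by nra.
have eY : 1 + Y <= expR Y by exact: expR_ge1Dx.
have /andP[zl zu] := truncn_itv (ltW (expR_gt0 Y)).
set z := Num.trunc (expR Y) in zl zu *.
have z6 : (6 < z)%N by rewrite truncn_ge_nat ?expR_ge0 //; apply: le_trans eY;
  lra.
clearbody z.
have z0 : (0 < z)%N by exact: leq_trans z6.
have zR : 0 < z%:R :> R by rewrite ltr0n.
have Lu : ln z%:R <= Y by rewrite -[leRHS]expRK ler_ln ?posrE ?expR_gt0.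
have Ll : Y <= ln z%:R + 1.
  have [_ l2] := ln2_bounds R.
  rewrite -[leLHS]expRK; apply: (@le_trans _ _ (ln z%:R + ln 2));
    last by rewrite lerD2l.
  rewrite -lnM ?posrE // ler_ln ?posrE ?expR_gt0 ?mulr_gt0 //.
  by apply: le_trans (ltW zu) _;
    rewrite -natrM ler_nat muln2 -addnn -addn1 leq_add2l.
exists z; split => //.
- rewrite -(@ler_nat R) natrX -ler_ln ?posrE ?exprn_gt0 // lnXn //.
  by rewrite -[_ *+ 10]mulr_natl -Y2; nra.
- by rewrite -Y2 expr2; nra.
Qed.

(** The final arithmetic, with [P = sqrt p], [L = ln z], [l = sqrt (ln p)], [h] even characters and
    [n] nonvanishing ones. The factor 32 is [4 * 2 * 4], from the squared half, [P <= 2 * N] and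
    [p <= 4 * h]. *)
Lemma count_arith (R : realType) (c1 c2 w0 B P p N L A h n l : R) :
  0 < c1 -> 0 < c2 -> 0 < w0 -> 0 < B -> 0 < P -> 0 < p -> 0 < N -> 0 < L ->
  0 <= n -> P <= 2 * N -> p <= 4 * h -> N / L / c1 <= A -> L <= l ->
  (h * (w0 * A) / 2) ^+ 2 <= n * (h * (B * (P * (c2 * (N / L))))) ->
  w0 ^+ 2 / (B * (32 * c1 ^+ 2 * c2)) * (p / l) <= n.
Proof.
move=> c10 c20 w00 B0 P0 p0 N0 L0 n0 PN ph QA Ll key.
have h0 : 0 < h by lra.
have l0 : 0 < l by lra.
have w20 : 0 < w0 ^+ 2 by rewrite exprn_gt0.
have Q0 : 0 < N / L by rewrite divr_gt0.
have key2 : w0 ^+ 2 * h * (N / L) <= n * (B * P * (4 * c1 ^+ 2 * c2)).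
  have k1 : (h * (w0 * (N / L / c1)) / 2) ^+ 2 <= (h * (w0 * A) / 2) ^+ 2.
    have t0 : 0 <= N / L / c1 by rewrite ltW // divr_gt0.
    have A0 : 0 <= A by exact: le_trans QA.
    rewrite ler_sqr ?nnegrE ?divr_ge0 ?mulr_ge0 ?invr_ge0 ?(ltW w00)
      ?(ltW h0) ?(ltW N0) ?(ltW L0) ?(ltW c10) //.
    by rewrite ler_pM2r ?invr_gt0 // !ler_pM2l.
  have hQ : 0 < h * (N / L) by rewrite mulr_gt0.
  have c12 : 0 < 4 * c1 ^+ 2 by rewrite mulr_gt0 // exprn_gt0.
  rewrite -(ler_pM2r hQ).
  have := le_trans k1 key.
  rewrite [X in X <= _ -> _](_ : _ =
    (w0 ^+ 2 * h * (N / L) * (h * (N / L))) / (4 * c1 ^+ 2)); last first.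
    by field; rewrite !gt_eqF.
  rewrite ler_pdivrMr // => /le_trans; apply.
  by rewrite le_eqVlt; apply/orP; left; apply/eqP; field; rewrite gt_eqF.
have key3 : w0 ^+ 2 * p * P <= n * (B * P * (32 * c1 ^+ 2 * c2)) * L.
  apply: (@le_trans _ _ (w0 ^+ 2 * (4 * h) * (2 * N))).
    apply: ler_pM => //; [by rewrite ltW // mulr_gt0 | exact: ltW |].
    by rewrite ler_pM2l.
  have -> : w0 ^+ 2 * (4 * h) * (2 * N) = 8 * (w0 ^+ 2 * h * (N / L)) * L.
    by field; rewrite gt_eqF.
  have := ler_wpM2r (ltW L0) key2; lra.
have D0 : 0 < B * (32 * c1 ^+ 2 * c2).
  by rewrite mulr_gt0 // mulr_gt0 // mulr_gt0 // exprn_gt0.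
rewrite mulrA ler_pdivrMr // mulrAC ler_pdivrMr // -(ler_pM2r P0).
apply: le_trans key3 _.
rewrite [leLHS](_ : _ = n * (B * (32 * c1 ^+ 2 * c2)) * P * L); last by ring.
rewrite [leRHS](_ : _ = n * (B * (32 * c1 ^+ 2 * c2)) * P * l); last by ring.
by rewrite ler_wpM2l // mulr_ge0 ?(ltW P0) // mulr_ge0 // ltW.
Qed.

Lemma main_count (R : realType) (x : R) (p : nat) : 0 < x -> prime p ->
  (expR 100 + 1) ^+ 2 <= p%:R :> R ->
  let s := Num.sqrt (pi * x) in
  exists S : {fset {ffun 'F_p -> R[i]}},
    (forall chi, chi \in S ->
       [/\ dirichlet_character chi, even_character chi & theta x chi != 0]) /\
    expR (- s ^+ 2) ^+ 2 /
      (3 * expR (1 / 2) * (1 + 2 / s) ^+ 2 * (32 * 960 ^+ 2 * 200 ^+ 2)) *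
      (p%:R / Num.sqrt (ln p%:R)) <= (#|` S|)%:R.
Proof.
move=> x0 pp pbig s.
have pix : 0 < pi * x by rewrite mulr_gt0 // pi_gt0.
have s0 : 0 < s by rewrite sqrtr_gt0.
have s2 : s ^+ 2 = pi * x by rewrite sqr_sqrtr // ltW.
have e100 : 100 <= expR 100 :> R by have := expR_ge1Dx (100 : R); lra.
have p100 : (100 < p)%N by rewrite -(@ltr_nat R); nra.
have pR : 0 < p%:R :> R by rewrite ltr0n prime_gt0.
set P : R := Num.sqrt p%:R.
have P0 : 0 < P by rewrite sqrtr_gt0.
have P2 : P ^+ 2 = p%:R by rewrite sqr_sqrtr // ltW.
(* The extra 1 in the bound on [p] allows for rounding [sqrt p] down to [N >= expR 100]. *)
have Pbig : expR 100 + 1 <= P.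
  rewrite -ler_sqr ?nnegrE ?(ltW P0) ?P2 //; lra.
have /andP[NP PN] := truncn_itv (ltW P0).
set N := Num.trunc P in NP PN; clearbody N.
have NR : expR 100 <= N%:R :> R by rewrite -natr1 in PN; lra.
have NP2 : P <= 2 * N%:R :> R by rewrite -natr1 in PN; lra.
have Np : (N ^ 2 <= p)%N.
  by rewrite -(@ler_nat R) natrX -P2 ler_sqr ?nnegrE ?(ltW P0).
have N2 : (1 < N)%N by rewrite -(@ltr_nat R); lra.
have Np' : (N < p)%N by apply: leq_trans Np; rewrite -{1}(expn1 N) ltn_exp2l.
have [z [z6 zN lNz zY]] := sieve_level_exists NR.
have z1 : (1 < z)%N by exact: leq_trans z6.
have zN1 : (1 < z <= N)%N.
  by rewrite z1; apply: leq_trans zN; rewrite -{1}(expn1 z) leq_pexp2l // ltnW.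
have hcount := rough_count_ge R z6 zN; have hgcd := gcd_sum_le zN1 lNz.
have lz := ln_ge_half R z1.
have p2 : (2 < p)%N by exact: leq_trans p100.
have [chi [chiP chi_inj orth]] := even_characters R pp p2.
have chiD k := (chiP k).1.
move: chi chiP chi_inj orth chiD;
  set h := (p.-1)./2 => chi chiP chi_inj orth chiD.
pose S := [pred k | theta x (chi k) != 0].
set w0 := expR (- s ^+ 2).
set B := 3 * expR (1 / 2) * (1 + 2 / s) ^+ 2.
have w00 : 0 < w0 by exact: expR_gt0.
have B0 : 0 < B.
  by rewrite !mulr_gt0 ?expR_gt0 ?addr_gt0 ?divr_gt0.
set A := rough_count R z N in hcount.
set G := gcd_sum R z N in hgcd.
set L := ln z%:R in hcount hgcd lz zY lNz.
have L0 : 0 < L by apply: lt_le_trans lz; rewrite divr_gt0.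
have N0 : 0 < N%:R :> R by rewrite ltr0n ltnW.
have Q0 : 0 < N%:R / L by rewrite divr_gt0.
have AQ : N%:R / L / 960 <= A by rewrite -mulrA -invfM [L * _]mulrC.
have GQ : G <= 200 ^+ 2 * (N%:R / L) by rewrite mulrA.
have c10 : 0 < 960 :> R by rewrite ltr0n.
have c20 : 0 < 200 ^+ 2 :> R by rewrite exprn_gt0 ?ltr0n.
have A0 : 0 < A := lt_le_trans (divr_gt0 Q0 c10) AQ.
have h4 : p%:R <= 4 * h%:R :> R.
  by rewrite -natrM ler_nat /h; clear - p2; lia.
have h0 : 0 < h%:R :> R by rewrite ltr0n /h; clear - p2; lia.
pose w n : R := expR (- (s ^+ 2 / p%:R * n%:R ^+ 2)).
have wE (k : 'I_h) T :
    \sum_(1 <= n < T) chi k n%:R * (expR (- (pi * n%:R ^+ 2 * x / p%:R)))%:C =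
    \sum_(1 <= n < T) chi k n%:R * (w n)%:C.
  apply: eq_bigr => n _; congr (_ * (expR _)%:C); congr (- _); rewrite s2.
  by field; rewrite gt_eqF.
(* Each vanishing theta has partial sums of size at most [w0 / 2] from some point on; as the
   characters are finitely many, one [T] serves them all. *)
have /choice[T0 T0P] : forall k : 'I_h, exists T0, theta x (chi k) = 0 ->
    forall T, (T0 <= T)%N ->
      normc (\sum_(1 <= n < T) chi k n%:R * (w n)%:C) <= w0 / 2.
  move=> k; have [th0|] := pselect (theta x (chi k) = 0); last by exists 0%N.
  have [T0 hT0] :=
    theta_eq0_small pp x0 (chiD k) th0 (divr_gt0 w00 (ltr0Sn R 1)).
  by exists T0 => _ T /hT0; rewrite wE.
pose T := maxn N.+1 (\max_k T0 k).
have TN : (N < T)%N by exact: leq_maxl.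
pose a k := normc (\sum_(1 <= n < T) chi k n%:R * (w n)%:C).
pose b k := normc (\sum_(1 <= m < N.+1 | rough z m) chi k m%:R).
have bA k : b k <= A by exact: norm_sum_chi_rough_le.
(* For [n <= N] one has [n ^ 2 <= p], so the weight [w n] is at least [w0]. *)
have hfirst : h%:R * (w0 * A) <= \sum_k a k * b k.
  apply: first_moment_ge => // [n|n /andP[n0 nN]]; first exact: expR_ge0.
  rewrite ler_expR lerN2 -[leRHS]mulr1 -mulrA ler_pM2l ?exprn_gt0 //.
  rewrite mulrC ler_pdivrMr // mul1r -natrX ler_nat.
  by apply: leq_trans Np; rewrite leq_exp2r.
have hsecond : \sum_k (a k * b k) ^+ 2 <= h%:R * (B * (P * G)).
  exact: second_moment_le.
have hS : h%:R * (w0 * A) / 2 <= \sum_(k | S k) a k * b k.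
  (* With the trivial bound [A] for the mollifier, the vanishing characters account for at most half
     of the first moment. *)
  have hnS : \sum_(k | ~~ S k) a k * b k <= h%:R * (w0 * A) / 2.
    apply: (@le_trans _ _ (\sum_(k : 'I_h) w0 / 2 * A)).
      rewrite big_mkcond; apply: ler_sum => k _.
      case: ifPn => [|_]; last by rewrite mulr_ge0 ?ltW // divr_gt0.
      rewrite /S /= negbK => /eqP th0; apply: ler_pM; rewrite ?normc_ge0 //.
      apply: T0P => //; apply: leq_trans (leq_maxr _ _).
      exact: (leq_bigmax k).
    rewrite sumr_const card_ord -mulr_natl; lra.
  move: hfirst; rewrite (bigID S) /=; lra.
have hS2 : \sum_(k | S k) (a k * b k) ^+ 2 <=
  h%:R * (B * (P * (200 ^+ 2 * (N%:R / L)))).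
  apply: (@le_trans _ _ (\sum_k (a k * b k) ^+ 2)).
    rewrite [leRHS](bigID S) /= lerDl; apply: sumr_ge0 => k _; exact: sqr_ge0.
  by apply: le_trans hsecond _; rewrite !ler_pM2l.
have U0 : 0 < h%:R * (w0 * A) / 2 by rewrite divr_gt0 // !mulr_gt0.
have V0 := mulr_gt0 h0 (mulr_gt0 B0 (mulr_gt0 P0 (mulr_gt0 c20 Q0))).
have key := sqr_sum_le_card U0 V0 hS hS2.
exists [fset y in [seq chi k | k <- enum S]]%fset; split.
  move=> y; rewrite inE => /mapP[k]; rewrite mem_enum => Sk ->.
  by have [? ?] := chiP k; split.
rewrite card_fseq undup_id; last by rewrite map_inj_uniq ?enum_uniq.
rewrite size_map -cardE.
have lp0 : 0 < ln p%:R :> R by rewrite ln_gt0 // ltr1n ltnW.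
have Lp : L <= Num.sqrt (ln p%:R).
  apply: le_trans zY _; rewrite ler_wsqrtr // ler_ln ?posrE //.
  by rewrite ler_nat ltnW.
exact: (count_arith c10 c20 w00 B0 P0 pR N0 L0 (ler0n _ _) NP2 h4 AQ Lp key).
Qed.

Theorem theorem1 (R : realType) (x : R) (hx : 0 < x) :
  exists2 c : R, 0 < c &
    \forall p \near \oo, prime p ->
      exists S : {fset {ffun 'F_p -> R[i]}},
        (forall chi, chi \in S ->
           [/\ dirichlet_character chi, even_character chi
             & theta x chi != 0]) /\
        c * (p%:R / Num.sqrt (ln p%:R)) <= (#|` S|)%:R.
Proof.
set s := Num.sqrt (pi * x).
have s0 : 0 < s by rewrite sqrtr_gt0 mulr_gt0 // pi_gt0.
exists (expR (- s ^+ 2) ^+ 2 /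
    (3 * expR (1 / 2) * (1 + 2 / s) ^+ 2 * (32 * 960 ^+ 2 * 200 ^+ 2))).
  have B0 : 0 < 3 * expR (1 / 2) * (1 + 2 / s) ^+ 2 :> R.
    by rewrite !mulr_gt0 ?expR_gt0 ?addr_gt0 ?divr_gt0.
  have n32 : 0 < 32 :> R by rewrite ltr0n.
  have n960 : 0 < 960 :> R by rewrite ltr0n.
  have n200 : 0 < 200 :> R by rewrite ltr0n.
  exact: (divr_gt0 (exprn_gt0 2 (expR_gt0 _)) (mulr_gt0 B0
    (mulr_gt0 (mulr_gt0 n32 (exprn_gt0 2 n960)) (exprn_gt0 2 n200)))).
near=> p => pp; apply: main_count => //.
by near: p; exact: nbhs_infty_ger.
Unshelve. all: by end_near. Qed.
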